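(* Let $K$ be a field of characteristic $0$, let $P=K[x_1,\dots,x_n]$, let $I\subseteq P$ be a homogeneous ideal, and let $\delta\in\mathbb{N}$ be such that $I_\delta\ne\{0\}$. Let $k=\mathcal{M}_{P/I}(2,\delta)$ be the $\mathcal{M}$-potential degree of the GCD of $I_\delta$. If $\mathcal{M}_{P/I}$ has $i$-maximal growth in degree $\delta$ for some $i\in\{2,\dots,n\}$, then $\langle I_{\le\delta}\rangle$ and $\langle I_{\le\delta+1}\rangle$ share the same GCD, $F$, of degree $k$.
   Context: $P$ has the standard grading. For a homogeneous ideal $I\subseteq P$, the sectional matrix of $P/I$ is the function $\mathcal{M}_{P/I}:\{1,\dots,n\}\times\mathbb{N}\to\mathbb{N}$, $\mathcal{M}_{P/I}(i,d)=\dim_K\big(P_d/(I+(L_1,\dots,L_{n-i}))_d\big)$, where $L_1,\dots,L_{n-i}$ are generic linear forms (the value is the same for all choices of coefficients in a suitable non-empty Zariski-open set). $\mathcal{M}_{P/I}$ has $i$-maximal growth in degree $d$ if $\mathcal{M}_{P/I}(i,d+1)=\sum_{j=1}^{i}\mathcal{M}_{P/I}(j,d)$. If $I_\delta\ne\{0\}$, the $\mathcal{M}$-potential degree of the GCD of $I_\delta$ is defined to be $\mathcal{M}_{P/I}(2,\delta)$. For $\delta\in\mathbb{N}$, $\langle I_{\le\delta}\rangle$ denotes the ideal of $P$ generated by the homogeneous elements of $I$ of degree $\le\delta$. The GCD of an ideal is the greatest common divisor (up to a nonzero scalar) of all its elements; the GCD may be $1$, of degree $0$. *)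

(* Defs.v *)
From mathcomp Require Export all_boot all_order all_algebra.
From mathcomp Require Export boolp classical_sets.
From mathcomp Require Export mpoly.

Set Implicit Arguments.
Unset Strict Implicit.
Unset Printing Implicit Defensive.

Import GRing.Theory.
Local Open Scope ring_scope.
Local Open Scope classical_set_scope.

(* [idealr_closed] from ring_quotient excludes the unit ideal, which must be
   allowed here. *)
Definition is_ideal (R : comNzRingType) (J : set R) : Prop :=
  [/\ J 0, forall f g, J f -> J g -> J (f + g) & forall a f, J f -> J (a * f)].

Definition ideal_gen (R : comNzRingType) (S : set R) : set R :=
  [set f | exists2 s : seq (R * R), forall u, u \in s -> S u.2 &
             f = \sum_(u <- s) u.1 * u.2].

Definition ideal_sum (R : comNzRingType) (I J : set R) : set R :=
  [set f + g | f in I & g in J].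

Definition divides (R : comNzRingType) (f g : R) : Prop :=
  exists q, g = q * f.

Definition is_gcd (R : comNzRingType) (J : set R) (F : R) : Prop :=
  (forall f, J f -> divides F f) /\
  (forall G, (forall f, J f -> divides G f) -> divides G F).

Definition homogeneous_ideal (n : nat) (K : fieldType)
    (I : set {mpoly K[n]}) : Prop :=
  is_ideal I /\ forall f d, I f -> I (pihomog mdeg d f).

Definition homog_part (n : nat) (K : fieldType) (J : set {mpoly K[n]})
    (d : nat) : set {mpoly K[n]} :=
  [set f | J f /\ f \is d.-homog].

Definition ideal_le (n : nat) (K : fieldType) (I : set {mpoly K[n]})
    (delta : nat) : set {mpoly K[n]} :=
  ideal_gen (\bigcup_(d in [set d | (d <= delta)%N]) homog_part I d).

(* From here on the polynomial ring has n.+1 variables: multinomials equips the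
   space [dhomog n.+1 K d] of forms of degree d with its finite-dimensional
   vector space structure only in that case. *)

(* [homog_part J d] as a subspace of the forms of degree d; see [hspaceP]. *)
Definition hspace (n : nat) (K : fieldType) (J : set {mpoly K[n.+1]})
    (d : nat) : {vspace dhomog n.+1 K d} :=
  xget 0%VS [set W : {vspace dhomog n.+1 K d} |
               forall f, f \in W <-> J (mpoly_of_dhomog f)].

(* dim_K (P_d / J_d) *)
Definition hilbert_fun (n : nat) (K : fieldType) (J : set {mpoly K[n.+1]})
    (d : nat) : nat :=
  (\dim {: dhomog n.+1 K d} - \dim (hspace J d))%N.

Definition linform (n r : nat) (K : fieldType) (A : 'M[K]_(r, n)) (s : 'I_r) :
    {mpoly K[n]} :=
  \sum_(j < n) A s j *: 'X_j.

Definition linforms_ideal (n r : nat) (K : fieldType) (A : 'M[K]_(r, n)) :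
    set {mpoly K[n]} :=
  ideal_gen (range (linform A)).

Definition zariski_open (N : nat) (K : fieldType) (U : set 'rV[K]_N) : Prop :=
  exists S : set {mpoly K[N]},
    U = [set v | exists2 g, S g & g.@[v 0] != 0].

(* m is the value of dim_K (P_d / (I + (L_1, ..., L_r))_d) for generic linear
   forms L_1, ..., L_r. *)
Definition generic_section_value (n : nat) (K : fieldType)
    (I : set {mpoly K[n.+1]}) (r d m : nat) : Prop :=
  exists U : set 'rV[K]_(r * n.+1),
    [/\ zariski_open U, U !=set0 &
        forall A : 'M[K]_(r, n.+1), U (mxvec A) ->
          hilbert_fun (ideal_sum I (linforms_ideal A)) d = m].

(* Meaningful for (1 <= i <= n.+1); over an infinite field the generic value
   exists and is unique for every homogeneous ideal I, so that the default 0
   of [xget] is not used. *)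
Definition sectional_matrix (n : nat) (K : fieldType)
    (I : set {mpoly K[n.+1]}) (i d : nat) : nat :=
  xget 0%N [set m | generic_section_value I (n.+1 - i) d m].

Definition maximal_growth (n : nat) (K : fieldType)
    (I : set {mpoly K[n.+1]}) (i d : nat) : Prop :=
  sectional_matrix I i d.+1 = (\sum_(1 <= j < i.+1) sectional_matrix I j d)%N.

Definition gcd_potential_degree (n : nat) (K : fieldType)
    (I : set {mpoly K[n.+1]}) (delta : nat) : nat :=
  sectional_matrix I 2 delta.

Lemma hspaceP (n : nat) (K : fieldType) (J : set {mpoly K[n.+1]}) (d : nat) :
  is_ideal J ->
  forall f : dhomog n.+1 K d, f \in hspace J d <-> J (mpoly_of_dhomog f).
Proof.
move=> [J0 JD JM]; rewrite /hspace.
case: xgetP => [W _ HW //|noW]; exfalso.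
pose sub (W : {vspace dhomog n.+1 K d}) :=
  forall f, f \in W -> J (mpoly_of_dhomog f).
have sub0 : sub 0%VS by move=> f; rewrite memv0 => /eqP ->.
pose N := \dim {: dhomog n.+1 K d}.
have big m : exists2 W, sub W & (m <= \dim W)%N.
  elim: m => [|m [W sW mW]]; first by exists 0%VS.
  have /existsNP [f Hf] : ~ forall f, f \in W <-> J (mpoly_of_dhomog f).
    exact: noW W.
  have [Jf fW] : J (mpoly_of_dhomog f) /\ f \notin W.
    split; last by apply/negP => fW; apply: Hf; split=> // _; apply: sW.
    by apply: contrapT => nJf; apply: Hf; split=> // fW; case: nJf; apply: sW.
  exists (W + <[f]>)%VS.
    move=> g /memv_addP [w wW [v /vlineP [c ->] ->]].
    rewrite linearD linearZ /= -mul_mpolyC.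
    by apply: JD; [apply: sW | apply: JM].
  apply: leq_ltn_trans mW _; rewrite ltn_neqAle dimvS ?addvSl // andbT.
  apply: contra fW => /eqP eqd.
  have /eqP -> : W == (W + <[f]>)%VS by rewrite eqEdim addvSl -eqd leqnn.
  by apply: (subvP (addvSr _ _)); exact: memv_line.
have [W _] := big N.+1.
by rewrite ltnNge dimvS ?subvf.
Qed.

(* Main.v *)
Require Import Defs.
From HB Require Import structures.
From mathcomp Require Import zify.

Set Implicit Arguments.
Unset Strict Implicit.
Unset Printing Implicit Defensive.

Import GRing.Theory.
Local Open Scope ring_scope.

(** Write [N = n.+1] for the number of variables and [M i d] for the sectional
    matrix of [I]. Everything happens on a generic plane of [K^N], which is cut
    out by [N - 2] generic linear forms: restricting [I] to it gives a
    homogeneous ideal [rI] of [K[Y, Z]], and [M 2 d] is the codimension of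
    [rI_d] in the [d.+1]-dimensional space of binary forms of degree [d]
    ([hilbert_fun_plane]).

    One more linear form lowers the Hilbert function in degree [d + 1] by at
    most its value in degree [d] ([hilbert_fun_section]), that is,
    [M i (d + 1) <= M i d + M (i - 1) (d + 1)]. Summing over the indices from
    [3] to [i], [i]-maximal growth in degree [delta] leaves
    [M 2 delta <= M 2 (delta + 1)] ([maximal_growth2]): on the plane, passing
    from degree [delta] to [delta + 1] raises the dimension of [rI] by at most
    one.

    Let [F], of degree [e], be the greatest common divisor of the forms of
    degree [delta] of [I]. The quotients [f / F] have no common factor, so that
    their zeros have codimension at least two and miss a generic plane outside
    of the origin: on such a plane they generate all forms of some degree [D]
    ([forms_gcd_plane], [generic_plane_full]). In two variables the dimensions
    of an ideal generated by forms of degree [m] are a concave function from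
    degree [m] on, because [Y J + Z J] has [Y Z J] in the intersection of its
    summands ([hspace_concave]). Growth by at most one in degree [m] thus
    persists, and since all forms of degree [D] are reached there was nothing
    missing in degree [m] ([hspace_full]). Hence the forms of degree [delta] of
    [rI] are exactly the multiples of the restriction of [F], and
    [M 2 delta = e]. By dimension, the forms of degree [delta + 1] of [rI] are
    again the multiples of [F]; the greatest common divisor [F'] of the forms of
    degree [delta + 1] of [I] then satisfies the same growth condition and has
    degree [e] too ([common_factor_degrees]).

    Finally [F'] divides [x_i f] for every [f] of degree [delta] in [I] and
    every variable [x_i], hence [f] since two variables are coprime; so [F']
    divides [F] and, having the same degree, is associate to it. The same
    argument shows that forms of smaller degree in [I] are divisible by the
    common divisors of degree [delta].

    Greatest common divisors exist because polynomial rings are factorial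
    ([factorial_poly], by Gauss' lemma), and the codimension statement is
    obtained from the same lemma: in a direction [p] with [f(p) <> 0], the
    ideal of the quotients contains a nonzero polynomial free of the variable
    along [p] ([forms_gcd]). Genericity is handled by lines: the dimension of
    an ideal generated by [I] and variable linear forms is lower
    semicontinuous ([hilbert_fun_semicontinuous]), and two nonempty open sets
    meet since [K] is infinite ([zariski_openI]). *)

(** * Divisibility and factorial rings *)

Section Divisibility.
Variable R : comNzRingType.
Implicit Types a b c : R.

Lemma divides_refl a : divides a a.
Proof. by exists 1; rewrite mul1r. Qed.

Lemma divides_trans a b c : divides a b -> divides b c -> divides a c.
Proof. by move=> [q ->] [r ->]; exists (r * q); rewrite mulrA. Qed.

Lemma divides_mull a b c : divides a b -> divides a (c * b).
Proof. by move=> [q ->]; exists (c * q); rewrite mulrA. Qed.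

Lemma divides_mulr a b c : divides a b -> divides a (b * c).
Proof. by rewrite mulrC; apply: divides_mull. Qed.

Lemma dividesD a b c : divides a b -> divides a c -> divides a (b + c).
Proof. by move=> [q ->] [r ->]; exists (q + r); rewrite mulrDl. Qed.

Lemma divides0 a : divides a 0.
Proof. by exists 0; rewrite mul0r. Qed.

Lemma divides_sum (T : Type) (r : seq T) (P : pred T) (F : T -> R) a :
  (forall i, P i -> divides a (F i)) -> divides a (\sum_(i <- r | P i) F i).
Proof. by move=> aF; apply: big_ind => //; [apply: divides0 | apply: dividesD]. Qed.

Lemma divides_ideal_gen (S : set R) a :
  (forall f, S f -> divides a f) -> forall f, ideal_gen S f -> divides a f.
Proof.
move=> aS f [s sS ->]; rewrite big_seq.
by apply: divides_sum => u us; apply/divides_mull/aS/sS.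
Qed.

Lemma ideal_gen_is_ideal (S : set R) : is_ideal (ideal_gen S).
Proof.
split; first by exists [::]; rewrite ?big_nil.
- move=> _ _ [s sS ->] [t tS ->]; exists (s ++ t); last by rewrite big_cat.
  by move=> u; rewrite mem_cat => /orP[/sS|/tS].
- move=> a _ [s sS ->]; exists [seq (a * u.1, u.2) | u <- s].
    by move=> _ /mapP[u /sS ? ->].
  by rewrite big_map mulr_sumr; apply: eq_bigr => u _; rewrite mulrA.
Qed.

Lemma ideal_gen_sub (S J : set R) :
  is_ideal J -> (forall f, S f -> J f) -> forall f, ideal_gen S f -> J f.
Proof.
move=> [J0 JD JM] SJ f [s sS ->]; rewrite big_seq.
by apply: big_ind => // u us; apply/JM/SJ/sS.
Qed.

Lemma mem_ideal_gen (S : set R) f : S f -> ideal_gen S f.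
Proof.
move=> Sf; exists [:: (1, f)]; last by rewrite big_seq1 mul1r.
by move=> u; rewrite inE => /eqP ->.
Qed.

Lemma ideal_sum_is_ideal (I J : set R) :
  is_ideal I -> is_ideal J -> is_ideal (ideal_sum I J).
Proof.
move=> [I0 ID IM] [J0 JD JM]; split.
- by exists 0 => //; exists 0 => //; rewrite addr0.
- move=> _ _ [a Ia [b Jb <-]] [c Ic [d Jd <-]].
  exists (a + c); first exact: ID.
  by exists (b + d); [apply: JD | rewrite addrACA].
- move=> c _ [a Ia [b Jb <-]]; exists (c * a); first exact: IM.
  by exists (c * b); [apply: JM | rewrite mulrDr].
Qed.

Lemma ideal_sumP (J : set R) (T : Type) (r : seq T) (P : pred T) (F : T -> R) :
  is_ideal J -> (forall i, P i -> J (F i)) -> J (\sum_(i <- r | P i) F i).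
Proof. by move=> [J0 JD _] JF; apply: big_ind. Qed.

Lemma idealB (J : set R) f g : is_ideal J -> J f -> J g -> J (f - g).
Proof. by move=> [_ JD JM] Jf Jg; apply: JD => //; rewrite -mulN1r; apply: JM. Qed.

End Divisibility.

Definition prime_elt (A : idomainType) (p : A) : Prop :=
  [/\ p != 0, ~ divides p 1 &
      forall a b, divides p (a * b) -> divides p a \/ divides p b].

Inductive prime_product (A : idomainType) : A -> Prop :=
| Prime_product_unit u : divides u 1 -> prime_product u
| Prime_product_mul p a : prime_elt p -> prime_product a -> prime_product (p * a).

Definition factorial_ring (A : idomainType) : Prop :=
  forall a : A, a != 0 -> prime_product a.

Lemma prime_productM (A : idomainType) (a b : A) :
  prime_product a -> prime_product b -> prime_product (a * b).
Proof.
move=> ppa ppb; elim: ppa => [u [v vu]|p a' pp _ IH]; last first.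
  by rewrite -mulrA; apply: Prime_product_mul.
elim: ppb => [w [x xw]|p b' pp _ IH]; last first.
  by rewrite mulrCA; apply: Prime_product_mul.
by apply: Prime_product_unit; exists (v * x); rewrite mulrACA -vu -xw mulr1.
Qed.

Section Factorial.
Variable R : idomainType.
Implicit Types (a b c p u : R) (f g h : {poly R}).

Lemma divides_polyC c f : divides c%:P f <-> forall i, divides c f`_i.
Proof.
split=> [[q ->] i|cf]; first by exists q`_i; rewrite coefMC.
pose q i := sval (cid (cf i)).
exists (\poly_(i < size f) q i); apply/polyP => i.
rewrite coefMC coef_poly; case: ltnP => [_|si]; last by rewrite nth_default // mul0r.
by rewrite /q; case: cid.
Qed.

(** If [p] divides neither [f] nor [g], the first coefficients that it misses
    multiply to the only term of a coefficient of [f * g] that it misses. *)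
Lemma prime_elt_polyC p : prime_elt p -> prime_elt p%:P.
Proof.
move=> [p0 pn1 pP]; split; first by rewrite polyC_eq0.
  by move=> /divides_polyC /(_ 0%N); rewrite coefC.
have first_miss f : ~ divides p%:P f ->
    exists2 i, ~ divides p f`_i & forall j, (j < i)%N -> divides p f`_j.
  move=> npf; have [i0 ni0] : exists i, ~ divides p f`_i.
    by apply/existsNP => pf; apply: npf; apply/divides_polyC.
  have ex : exists i, `[< ~ divides p f`_i >] by exists i0; apply/asboolP.
  case: (ex_minnP ex) => i /asboolP ni imin; exists i => // j ji.
  apply: contrapT => nj; have /imin : `[< ~ divides p f`_j >] by apply/asboolP.
  by rewrite leqNgt ji.
move=> f g pfg; apply: contrapT => /not_orP [/first_miss [i ni li]].
move=> /first_miss [j nj lj].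
have /divides_polyC /(_ (i + j)%N) := pfg.
have lti : (i < (i + j).+1)%N by rewrite ltnS leq_addr.
rewrite coefM (bigD1 (Ordinal lti)) //= addKn => pfgij.
have [] // : divides p f`_i \/ divides p g`_j.
apply: pP.
set s := \sum_(_ < _ | _) _ in pfgij.
have [q qs] : divides p s.
  apply: divides_sum => k nki; have [ki|ik] := ltnP k i.
    by apply/divides_mulr/li.
  apply/divides_mull/lj; rewrite ltn_subLR ?(ltnSE (ltn_ord k)) //.
  by rewrite ltn_add2r ltn_neqAle ik eq_sym nki.
have [q' ] := pfgij; rewrite qs => /(canRL (addrK _)) ->.
by exists (q' - q); rewrite mulrBl.
Qed.

Definition primitive h : Prop := forall c, divides c%:P h -> divides c 1.

(** Gauss' lemma: the prime factors of [c] divide the cofactor of [h] one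
    after the other. *)
Lemma gauss_primitive h c f : prime_product c -> c != 0 -> primitive h ->
  divides h (c%:P * f) -> divides h f.
Proof.
move=> + + hprim; elim=> [u [v vu] _ [q hq]|p a pp _ IH pa0 [q hq]].
  exists (v%:P * q); rewrite -mulrA -hq mulrA -polyCM -vu mul1r //.
move: pa0; rewrite mulf_eq0 negb_or => /andP[p0 a0].
have [_ pn1 pP] := pp.
have [_ _ pPP] := prime_elt_polyC pp.
have : divides p%:P (q * h).
  by exists (a%:P * f); rewrite -hq polyCM -mulrA mulrC.
case/pPP => [[q' qq']|/hprim //].
apply: IH => //; exists q'; have pP0 : p%:P != 0 by rewrite polyC_eq0.
by apply: (mulfI pP0); rewrite mulrA -polyCM hq qq' mulrCA mulrA.
Qed.

Hypothesis facR : factorial_ring R.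

(** The content is split off one prime of the leading coefficient at a time:
    [a] is a common multiple of the constants that still divide [h], and a prime
    factor of [a] is dropped once it does not divide [h]. *)
Lemma primitive_part h : h != 0 ->
  exists c g, [/\ c != 0, h = c%:P * g & primitive g].
Proof.
move=> h0.
suff gen a : prime_product a -> forall h, h != 0 ->
    (forall c, divides c%:P h -> divides c a) ->
    exists c g, [/\ c != 0, h = c%:P * g & primitive g].
  apply: (gen (lead_coef h)) => //; first by apply: facR; rewrite lead_coef_eq0.
  by move=> c /divides_polyC; apply.
elim=> {h h0} [u u1 h h0 hu|p {}a [p0 _ pP] _ IH h h0 ha].
  exists 1, h; rewrite oner_eq0 mul1r; split=> // c /hu cu.
  exact: divides_trans u1.
have [[g hg]|nph] := EM (divides p%:P h).
  have g0 : g != 0 by apply: contraNneq h0 => g0; rewrite hg g0 mul0r.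
  have [|c [g' [c0 gg' pg']]] := IH g g0.
    move=> c [q gq]; have [] := ha (c * p).
      by exists q; rewrite hg gq polyCM mulrA.
    move=> e epa; exists e; apply: (mulfI p0).
    by rewrite epa [RHS]mulrC mulrA.
  exists (p * c), g'; split=> //; first by rewrite mulf_neq0.
  by rewrite hg gg' polyCM mulrC mulrA.
apply: IH => // c ch; have [e pae] := ha _ ch.
have [[e' ee']|[c' cc']] : divides p e \/ divides p c.
- by apply: pP; exists a; rewrite -pae mulrC.
- by exists e'; apply: (mulfI p0); rewrite pae ee' mulrA [e' * p]mulrC.
- case: nph; apply: divides_trans ch.
  by exists c'%:P; rewrite cc' polyCM.
Qed.

(** An element of least degree in the ideal divides all others up to a
    constant, by pseudo-division; its primitive part divides them by Gauss'
    lemma. The constant [c] becomes essential when the members of [J] have no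
    common factor: it is then itself in [J], up to a unit. *)
Lemma ideal_poly_gcd (J : set {poly R}) : is_ideal J -> (exists2 f, J f & f != 0) ->
  exists c h, [/\ c != 0, J (c%:P * h), primitive h & forall f, J f -> divides h f].
Proof.
move=> idJ [f0 Jf0 f00]; have [J0 JD JM] := idJ.
pose Q k := `[< exists f, [/\ J f, f != 0 & size f = k] >].
have ex : exists k, Q k by exists (size f0); apply/asboolP; exists f0.
case: (ex_minnP ex) => k /asboolP [h [Jh h0 sh]] kmin.
have [c [g [c0 hg pg]]] := primitive_part h0.
exists c, g; split=> //; first by rewrite -hg.
move=> f Jf; have := Pdiv.Idomain.divp_eq f h.
set l := _ ^+ _ => lf.
have l0 : l != 0 by rewrite expf_neq0 // lead_coef_eq0.
have r0 : f %% h = 0.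
  apply: contrapT => /eqP r0.
  have Jr : J (f %% h).
    rewrite -[f %% h](addKr (f %/ h * h)) -lf addrC.
    by apply: idealB => //; [rewrite -mul_polyC; apply: JM | apply: JM].
  have /kmin : Q (size (f %% h)) by apply/asboolP; exists (f %% h).
  by rewrite -sh leqNgt ltn_modp h0.
apply: (gauss_primitive (facR l0)) => //.
by exists (f %/ h * c%:P); rewrite mul_polyC lf r0 addr0 -mulrA -hg.
Qed.

Lemma prime_product_polyC c : prime_product c -> prime_product c%:P.
Proof.
elim=> [u [v vu]|p a pp _ IH].
  by apply: Prime_product_unit; exists v%:P; rewrite -polyCM -vu.
by rewrite polyCM; apply: Prime_product_mul => //; apply: prime_elt_polyC.
Qed.

Lemma primitive_polyC_unit c : primitive c%:P -> divides c 1.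
Proof. by apply; apply: divides_refl. Qed.

(** When [h] divides [a * b], the ideal of [h] and [a] contains a constant
    multiple of a common divisor of both. Either this divisor is associate to
    [h], which then divides [a], or it is a constant, which puts a constant
    multiple of [b] in the ideal of [h]. *)
Lemma irreducible_primitive_prime h : primitive h -> (1 < size h)%N ->
  (forall f g, h = f * g -> (size f < size h)%N -> (size g < size h)%N -> False) ->
  prime_elt h.
Proof.
move=> hprim h1 irr; have h0 : h != 0 by rewrite -size_poly_gt0 (ltn_trans _ h1).
split=> //.
  move=> [q /(congr1 (@size _ \o val)) /=]; rewrite size_poly1.
  have [->|q0] := eqVneq q 0; first by rewrite mul0r size_poly0.
  rewrite size_mul // => /eqP; rewrite eq_sym -subn1 eqn_leq => /andP[].
  rewrite leq_subLR; move: (q0); rewrite -size_poly_gt0 => q0' le2 _; move: le2.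
  by rewrite leqNgt -[(1 + 1)%N]/2%N (leq_add q0' h1).
move=> a b [q abq]; have [->|a0] := eqVneq a 0; first by left; apply: divides0.
pose J := [set x * h + y * a | x in setT & y in setT]%classic.
have idJ : is_ideal J.
  split; first by exists 0 => //; exists 0 => //; rewrite !mul0r addr0.
    move=> _ _ [x _ [y _ <-]] [x' _ [y' _ <-]].
    by exists (x + x') => //; exists (y + y') => //; rewrite !mulrDl addrACA.
  move=> c _ [x _ [y _ <-]]; exists (c * x) => //; exists (c * y) => //.
  by rewrite mulrDr !mulrA.
have Jh : J h by exists 1 => //; exists 0 => //; rewrite mul1r mul0r addr0.
have Ja : J a by exists 0 => //; exists 1 => //; rewrite mul1r mul0r add0r.
have [|c [g [c0 Jcg gprim gJ]]] := ideal_poly_gcd idJ; first by exists a.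
have [r hr] := gJ _ Jh.
have [r0 g0] : r != 0 /\ g != 0.
  by apply/andP; rewrite -negb_or -mulf_eq0 -hr.
have szh : size h = (size r + size g).-1 by rewrite hr size_mul.
have [sr|sr] := ltnP (size r) (size h).
  have [sg|sg] := ltnP (size g) (size h); first by case: (irr r g).
  left; have : size r = 1%N.
    apply/eqP; rewrite eqn_leq size_poly_gt0 r0 andbT -(leq_add2r (size g)).
    rewrite add1n -(prednK (n := (size r + size g))); first by rewrite -szh ltnS.
    by rewrite addn_gt0 size_poly_gt0 r0.
  move=> /eqP /size_poly1P [d d0 rd].
  have [e ed] : divides d 1.
    by apply: hprim; rewrite hr rd; exists g; rewrite mulrC.
  apply: divides_trans (gJ _ Ja); exists e%:P.
  by rewrite hr rd mulrA -polyCM -ed mul1r.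
right; have : size g = 1%N.
  apply/eqP; rewrite eqn_leq size_poly_gt0 g0 andbT -(leq_add2l (size r)).
  rewrite addn1 -(prednK (n := (size r + size g))); first by rewrite -szh ltnS.
  by rewrite addn_gt0 size_poly_gt0 r0.
move=> /eqP /size_poly1P [d d0 gd].
have [x _ [y _ Hxy]] := Jcg.
apply: (gauss_primitive (c := c * d)) => //; first by apply/facR/mulf_neq0.
  by rewrite mulf_neq0.
exists (x * b + y * q).
by rewrite polyCM -gd -Hxy !mulrDl -!mulrA abq [b * h]mulrC.
Qed.

(** Without factorization into smaller degrees, the primitive part is prime. *)
Theorem factorial_poly : factorial_ring {poly R}.
Proof.
move=> f; have [k] := ubnP (size f); elim: k f => // k IH f; rewrite ltnS => sf f0.
have [c [h [c0 fh hprim]]] := primitive_part f0.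
have h0 : h != 0 by apply: contraNneq f0 => h0; rewrite fh h0 mulr0.
rewrite fh; apply: prime_productM; first exact/prime_product_polyC/facR.
have sh : (size h <= k)%N by rewrite (leq_trans _ sf) // fh mul_polyC size_scale.
have [|h1] := leqP (size h) 1.
  move=> /size1_polyC hE; apply: Prime_product_unit; move: hprim; rewrite hE.
  by move=> /primitive_polyC_unit [d dE]; exists d%:P; rewrite -polyCM -dE.
have [[a [b [hab sa sb]]]|irr] :=
  EM (exists a b : {poly R}, [/\ h = a * b, (size a < size h)%N & (size b < size h)%N]).
  have /andP[a0 b0] : (a != 0) && (b != 0) by rewrite -negb_or -mulf_eq0 -hab.
  by rewrite hab; apply: prime_productM; apply: IH => //; apply: leq_trans sh.
rewrite -[h]mulr1; apply: Prime_product_mul.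
  by apply: irreducible_primitive_prime => // a b ? ? ?; apply: irr; exists a, b.
by apply: Prime_product_unit; apply: divides_refl.
Qed.

End Factorial.

Lemma factorial_ring_iso (A B : idomainType) (f : {rmorphism A -> B})
    (g : {rmorphism B -> A}) :
  cancel f g -> cancel g f -> factorial_ring A -> factorial_ring B.
Proof.
move=> fK gK facA b b0.
have divf x y : divides (f x) (f y) <-> divides x y.
  split=> [[q]|[q ->]]; last by exists (f q); rewrite rmorphM.
  by move=> /(congr1 g); rewrite rmorphM !fK => ->; exists (g q).
have: prime_product (g b).
  by apply: facA; apply: contraNneq b0 => gb; rewrite -[b]gK gb rmorph0.
rewrite -{2}[b]gK; elim=> [u u1|p a [p0 p1 pP] _ IH].
  by apply: Prime_product_unit; rewrite -(rmorph1 f) divf.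
rewrite rmorphM; apply: Prime_product_mul => //; split.
- by apply: contraNneq p0 => fp0; rewrite -[p]fK fp0 rmorph0.
- by rewrite -(rmorph1 f) divf.
- move=> x y; rewrite -[x]gK -[y]gK -rmorphM !divf; exact: pP.
Qed.

(** * Polynomial rings are factorial *)

Lemma mpoly_morph_ext (n : nat) (K : fieldType) (A : comNzRingType)
    (f g : {rmorphism {mpoly K[n]} -> A}) :
  (forall c, f c%:MP = g c%:MP) -> (forall i, f 'X_i = g 'X_i) -> f =1 g.
Proof.
move=> fgC fgX q; rewrite (mpolyE q) !rmorph_sum; apply: eq_bigr => m _.
rewrite -mul_mpolyC !rmorphM fgC mpolyXE_id !rmorph_prod; congr (_ * _).
by apply: eq_bigr => i _; rewrite !rmorphXn fgX.
Qed.

Section Along.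
Variables (n : nat) (K : fieldType) (p : 'I_n.+1 -> K).
Local Notation P := {mpoly K[n.+1]}.
Local Notation Q := {mpoly K[n]}.

(** The expansion of [f (X * p + (0, x))] in powers of [X]: the polynomial ring
    seen as a ring of univariate polynomials in the direction of [p]. *)
Definition along : P -> {poly Q} :=
  mmap (@polyC Q \o @mpolyC n K)
    (fun i => (p i)%:MP%:P * 'X + oapp (fun j => ('X_j)%:P) 0 (unlift ord0 i)).

HB.instance Definition _ := GRing.RMorphism.on along.

Lemma alongC c : along c%:MP = c%:MP%:P.
Proof. by rewrite /along mmapC. Qed.

Lemma alongX i :
  along 'X_i = (p i)%:MP%:P * 'X + oapp (fun j => ('X_j)%:P) 0 (unlift ord0 i).
Proof. by rewrite /along mmapX mmap1U. Qed.

Lemma horner_map_along (v : 'I_n -> K) t (f : P) :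
  (map_poly (meval v) (along f)).[t]
  = f.@[fun i => p i * t + oapp v 0 (unlift ord0 i)].
Proof.
apply: (mpoly_morph_ext (f := horner_eval t \o map_poly (meval v) \o along)
  (g := meval _)) => [c|i] /=; rewrite /horner_eval.
  by rewrite alongC map_polyC /= mevalC hornerC mevalC.
rewrite alongX rmorphD rmorphM /= map_polyX !map_polyC /= mevalC mevalXU !hornerE.
congr (_ + _); case: unlift => [j|] /=; last by rewrite rmorph0 horner0.
by rewrite map_polyC /= mevalXU hornerC.
Qed.

Hypothesis p0 : p ord0 != 0.

Definition proj_along : Q -> P :=
  mmap (@mpolyC n.+1 K)
    (fun j => 'X_(lift ord0 j) - (p (lift ord0 j) / p ord0) *: 'X_ord0).

HB.instance Definition _ := GRing.RMorphism.on proj_along.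

Lemma proj_alongC c : proj_along c%:MP = c%:MP.
Proof. by rewrite /proj_along mmapC. Qed.

Lemma proj_alongX j :
  proj_along 'X_j = 'X_(lift ord0 j) - (p (lift ord0 j) / p ord0) *: 'X_ord0.
Proof. by rewrite /proj_along mmapX mmap1U. Qed.

Definition unalong : {poly Q} -> P :=
  horner_eval ((p ord0)^-1 *: 'X_ord0) \o map_poly proj_along.

HB.instance Definition _ := GRing.RMorphism.on unalong.

Lemma unalongC q : unalong q%:P = proj_along q.
Proof. by rewrite /unalong /= map_polyC /horner_eval hornerC. Qed.

Lemma unalongX : unalong 'X = (p ord0)^-1 *: 'X_ord0.
Proof. by rewrite /unalong /= map_polyX /horner_eval hornerX. Qed.

Lemma alongK : cancel along unalong.
Proof.
move=> f; apply: (mpoly_morph_ext (f := unalong \o along) (g := idfun)) => [c|i] /=.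
  by rewrite alongC unalongC proj_alongC.
rewrite alongX rmorphD rmorphM /= unalongC proj_alongC unalongX mul_mpolyC scalerA.
case: unliftP => [j ->|->] /=.
  by rewrite unalongC proj_alongX addrC subrK.
by rewrite rmorph0 addr0 divff // scale1r.
Qed.

Lemma along_proj q : along (proj_along q) = q%:P.
Proof.
apply: (mpoly_morph_ext (f := along \o proj_along) (g := polyC)) => [c|j] /=.
  by rewrite proj_alongC alongC.
rewrite proj_alongX -mul_mpolyC rmorphB rmorphM /= alongC !alongX.
rewrite liftK unlift_none /= addr0 mulrA -polyCM -mpolyCM divfK //.
by rewrite addrAC subrr add0r.
Qed.

Lemma unalongK : cancel unalong along.
Proof.
elim/poly_ind => [|g c IH]; first by rewrite !rmorph0.
rewrite !rmorphD !rmorphM /= IH unalongC along_proj unalongX.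
rewrite -mul_mpolyC rmorphM /= alongC alongX unlift_none /= addr0.
congr (g * _ + _); rewrite mulrA -polyCM -mpolyCM mulVf ?mul1r //.

Qed.

(** Moving along [p] does not change the value of a polynomial pulled back
    from the quotient by the direction [p]. *)
Lemma meval_proj_along q t v :
  (proj_along q).@[fun i => v i + t * p i] = (proj_along q).@[v].
Proof.
apply: (mpoly_morph_ext (f := meval (fun i => v i + t * p i) \o proj_along)
  (g := meval v \o proj_along)) => [c|j] /=.
  by rewrite proj_alongC !mevalC.
rewrite proj_alongX !mevalB !mevalZ !mevalXU mulrDr opprD addrACA.
by rewrite [_ * (t * _)]mulrCA divfK // subrr addr0.
Qed.

End Along.

Theorem factorial_mpoly (n : nat) (K : fieldType) : factorial_ring {mpoly K[n]}.
Proof.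
elim: n => [|n IH].
  move=> f f0; apply: Prime_product_unit.
  have [c cf] : exists c, f = c%:MP.
    exists f@_0; apply/mpolyP => m; rewrite mcoeffC.
    have -> : m = 0%MM by apply/mnmP => i; case: i.
    by rewrite eqxx mulr1.
  exists (c^-1)%:MP; rewrite cf -mpolyCM mulVf //.
  by apply: contraNneq f0 => c0; rewrite cf c0.
pose p (i : 'I_n.+1) : K := 1.
have p0 : p ord0 != 0 by apply: oner_neq0.
exact: (factorial_ring_iso (unalongK p0) (alongK p0) (factorial_poly IH)).
Qed.

Section Nonroot.
Variables (K : fieldType) (charK0 : [pchar K] =i pred0).

Lemma poly_nonroot (h : {poly K}) : h != 0 -> exists t, h.[t] != 0.
Proof.
move=> h0; apply: contrapT => noroot.
pose rs : seq K := [seq k%:R | k <- iota 0 (size h)].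
have : (size rs < size h)%N.
  apply: max_poly_roots => //.
    apply/allP => t _; rewrite rootE; apply: contrapT => /negP ht.
    by apply: noroot; exists t.
  rewrite map_inj_uniq ?iota_uniq // => i j.
  have /pcharf0P ch := charK0.
  wlog le_ij : i j / (i <= j)%N.
    by move=> H; case/orP: (leq_total i j) => le; [|move=> /esym]; move/H => ->.
  move=> /eqP; rewrite eq_sym -subr_eq0 -natrB // ch subn_eq0 => le_ji.
  by apply/eqP; rewrite eqn_leq le_ij.
by rewrite size_map size_iota ltnn.
Qed.

Lemma mpoly_nonroot (n : nat) (f : {mpoly K[n]}) : f != 0 -> exists v, f.@[v] != 0.
Proof.
elim: n f => [|n IH] f f0.
  exists (fun=> 0); apply: contra_neq f0 => fv; apply/mpolyP => m.
  rewrite mcoeff0 -{}fv (mpolyE f) rmorph_sum /= raddf_sum /=.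
  apply: eq_bigr => m' _; rewrite mevalZ mcoeffZ mcoeffX mevalX big_ord0.
  have -> : m' = m by apply/mnmP => i; case: i.
  by rewrite eqxx.
pose p (i : 'I_n.+1) : K := 1.
have p0 : p ord0 != 0 by apply: oner_neq0.
have g0 : along p f != 0 by rewrite -(rmorph0 (along p)) (can_eq (alongK p0)).
have [v gv] : exists v, (lead_coef (along p f)).@[v] != 0.
  by apply: IH; rewrite lead_coef_eq0.
have [t ht] : exists t, (map_poly (meval v) (along p f)).[t] != 0.
  apply: poly_nonroot; apply: contra_neq gv => g0'.
  by rewrite /lead_coef -(coef_map (meval v)) g0' coef0.
by exists (fun i => p i * t + oapp v 0 (unlift ord0 i)); rewrite -horner_map_along.
Qed.

End Nonroot.

(** * Homogeneous components, factors and ideals *)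

Local Notation "d .-form" := (@ishomog1 _ _ d mdeg)
  (at level 1, format "d .-form") : form_scope.
Local Notation "f .{ d }" := (pihomog mdeg d f)
  (at level 2, format "f .{ d }").

Section Components.
Variables (n : nat) (K : fieldType).
Implicit Types f g a b w : {mpoly K[n]}.

Lemma homog_components f k : (msize f <= k)%N -> f = \sum_(0 <= d < k) f.{d}.
Proof. by rewrite big_mkord; apply: pihomog_partitionE. Qed.

Lemma homog_component_ne0 f : f != 0 -> exists d, f.{d} != 0.
Proof.
move=> f0; apply: contrapT => comp0; case/negP: f0; apply/eqP.
rewrite (homog_components (leqnn (msize f))) big1 // => d _.
by apply: contrapT => /eqP fd; apply: comp0; exists d.
Qed.

Lemma homog_comp_formE d e f :
  f \is d.-form -> f.{e} = if d == e then f else 0.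
Proof.
by move=> fd; case: eqVneq => [<-|/pihomog_ne0 ->//]; rewrite pihomog_dE.
Qed.

Lemma homog_compM_form d e f g :
  g \is e.-form -> (f * g).{(d + e)%N} = f.{d} * g.
Proof.
move=> ge; pose k := maxn (msize f) d.+1.
rewrite {1}(homog_components (leq_maxl _ d.+1 : (_ <= k)%N)) mulr_suml raddf_sum /=.
have dk : (d < k)%N by rewrite leq_max leqnn orbT.
rewrite big_mkord (bigD1 (Ordinal dk)) //= big1 ?addr0; last first.
  move=> i ni; rewrite (homog_comp_formE _ (dhomogM (pihomogP _ i f) ge)).
  by rewrite eqn_add2r; case: eqP => // id; case/eqP: ni; apply: val_inj.
by rewrite (homog_comp_formE _ (dhomogM (pihomogP _ d f) ge)) eqxx.
Qed.

Lemma homog_compM_form_lt d e f g :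
  g \is e.-form -> (d < e)%N -> (f * g).{d} = 0.
Proof.
move=> ge lt_de.
rewrite {1}(homog_components (leqnn (msize f))) mulr_suml raddf_sum /=.
apply: big1 => i _; rewrite (homog_comp_formE _ (dhomogM (pihomogP _ i f) ge)).
by case: eqP => // id; move: lt_de; rewrite -id ltnNge leq_addl.
Qed.

Lemma homog_compM d f g : (f * g).{d} = \sum_(0 <= i < d.+1) f.{i} * g.{(d - i)%N}.
Proof.
pose k := maxn (msize f) d.+1.
rewrite {1}(homog_components (leq_maxl _ d.+1 : (_ <= k)%N)) mulr_suml raddf_sum /=.
rewrite (big_cat_nat (n := d.+1)) ?leq_maxr //= [X in _ + X]big1_seq ?addr0.
  apply: eq_big_nat => i; rewrite ltnS => /andP[_ id].
  by rewrite -{1}(subnK id) mulrC (homog_compM_form _ _ (pihomogP _ i f)) mulrC.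
move=> i /andP[_]; rewrite mem_index_iota => /andP[di _].
by rewrite mulrC (homog_compM_form_lt _ (pihomogP _ i f) di).
Qed.

(** A factor of a nonzero form is a form: otherwise the products of the lowest
    and of the highest components of the factors are components of different
    degrees. *)
Lemma form_factors d f g : f * g != 0 -> f * g \is d.-form ->
  exists2 i, f \is i.-form & exists2 j, g \is j.-form & d = (i + j)%N.
Proof.
move=> fg0 fgd; have /andP[f0 g0] : (f != 0) && (g != 0).
  by rewrite -negb_or -mulf_eq0.
have low (h : {mpoly K[n]}) : h != 0 ->
    exists2 i, h.{i} != 0 & forall j, h.{j} != 0 -> (i <= j)%N.
  by move=> hn0; have ex := homog_component_ne0 hn0; case: (ex_minnP ex) => i; exists i.
have high (h : {mpoly K[n]}) : h != 0 ->
    exists2 i, h.{i} != 0 & forall j, h.{j} != 0 -> (j <= i)%N.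
  move=> hn0; have ex := homog_component_ne0 hn0.
  have ub i : h.{i} != 0 -> (i <= msize h)%N.
    apply: contraTT; rewrite negbK -ltnNge => hi; rewrite pihomogE big_seq_cond.
    rewrite big1 // => m /andP[/msize_mdeg_lt mh /eqP mi].
    by move: hi; rewrite -mi ltnNge ltnW.
  by case: (ex_maxnP ex ub) => i; exists i.
have extreme i j : f.{i} != 0 -> g.{j} != 0 ->
    (forall k, (k <= i + j)%N -> k != i -> f.{k} = 0 \/ g.{(i + j - k)%N} = 0) ->
    d = (i + j)%N.
  move=> fi gj fgk; have : (f * g).{(i + j)%N} = f.{i} * g.{j}.
    rewrite homog_compM big_mkord (bigD1 (Ordinal (leq_addr j i : i < (i + j).+1)%N)) //=.
    rewrite addKn big1 ?addr0 // => k nk.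
    by case: (fgk k) => [||->|->]; rewrite ?mul0r ?mulr0 // -ltnS.
  rewrite (homog_comp_formE _ fgd); case: eqP => // _ /esym/eqP.
  by rewrite mulf_eq0 (negbTE fi) (negbTE gj).
have [i0 fi0 mini] := low f f0; have [i1 fi1 maxi] := high f f0.
have [j0 gj0 minj] := low g g0; have [j1 gj1 maxj] := high g g0.
have e0 : d = (i0 + j0)%N.
  apply: extreme => // k kij nk.
  have [|/mini ik] := eqVneq f.{k} 0; first by left.
  have [|/minj] := eqVneq g.{(i0 + j0 - k)%N} 0; first by right.
  by rewrite leq_subRL // leq_add2r => ki; move: nk; rewrite eqn_leq ik ki.
have e1 : d = (i1 + j1)%N.
  apply: extreme => // k kij nk.
  have [|/maxi ik] := eqVneq f.{k} 0; first by left.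
  have [|/maxj] := eqVneq g.{(i1 + j1 - k)%N} 0; first by right.
  rewrite leq_subLR addnC [(k + j1)%N]addnC leq_add2l => ki.
  by move: nk; rewrite eqn_leq ik ki.
have [i01 j01] : i0 = i1 /\ j0 = j1.
  have lei := mini _ fi1; have lej := minj _ gj1.
  suff ei : i0 = i1 by split=> //; apply/eqP; rewrite -(eqn_add2l i0) {2}ei -e0 -e1.
  apply/eqP; rewrite eqn_leq lei -(leq_add2r j1) -e1 e0 leq_add2l //.
have pure (h : {mpoly K[n]}) i : h != 0 -> (forall j, h.{j} != 0 -> (i <= j)%N) ->
    (forall j, h.{j} != 0 -> (j <= i)%N) -> h \is i.-form.
  move=> h0 mi ma; rewrite (homog_components (leqnn (msize h))).
  apply: rpred_sum => j _; have [->|hj] := eqVneq h.{j} 0; first exact: rpred0.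
  have -> : i = j by apply/eqP; rewrite eqn_leq mi // ma.
  exact: pihomogP.
exists i0; first by apply: pure => //; rewrite i01.
by exists j0 => //; apply: pure => //; rewrite j01.
Qed.

Lemma form0_const f : f \is 0.-form -> f = (f@_0)%:MP.
Proof.
move=> f0; apply/mpolyP => m; rewrite mcoeffC eq_sym.
have [->|m0] := eqVneq m 0%MM; first by rewrite mulr1.
by rewrite mulr0 (dhomog_nemf_coeff f0) // mdeg_eq0.
Qed.

Lemma form_meval0 d f : f \is d.-form -> (0 < d)%N -> f.@[fun=> 0] = 0.
Proof.
move=> fd d0; rewrite (mpolyE f) raddf_sum /= big_seq big1 // => m /(dhomog_mf fd) md.
rewrite mevalZ mevalX; case: (pickP (fun i => m i != 0%N)) => [i mi|m0].
  by rewrite (bigD1 i) //= expr0n (negbTE mi) mul0r mulr0.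
have {}md : mdeg m = d := md.
by move: d0; rewrite -md mdegE big1 // => i _; apply/eqP; have /negbFE := m0 i.
Qed.

Lemma msize_form d f : f != 0 -> f \is d.-form -> msize f = d.+1.
Proof.
move=> f0 fd; rewrite -mlead_deg //; congr _.+1.
exact: (dhomog_mf fd (mlead_supp f0)).
Qed.

Lemma ideal_gen_homog (S : set {mpoly K[n]}) :
  (forall f, S f -> exists d, f \is d.-form) -> homogeneous_ideal (ideal_gen S).
Proof.
move=> Sform; split; first exact: ideal_gen_is_ideal.
move=> _ d [s sS ->]; have [_ _ JM] := ideal_gen_is_ideal S.
rewrite raddf_sum big_seq /=; apply: ideal_sumP; first exact: ideal_gen_is_ideal.
move=> u /sS Su; have [e ue] := Sform _ Su.
have [le_ed|lt_de] := leqP e d; last first.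
  by rewrite (homog_compM_form_lt _ ue) //; case: (ideal_gen_is_ideal S).
by rewrite -(subnK le_ed) (homog_compM_form _ _ ue); apply/JM/mem_ideal_gen.
Qed.

Lemma ideal_sum_homog (I J : set {mpoly K[n]}) :
  homogeneous_ideal I -> homogeneous_ideal J -> homogeneous_ideal (ideal_sum I J).
Proof.
move=> [idI hI] [idJ hJ]; split; first exact: ideal_sum_is_ideal.
move=> _ d [f If [g Jg <-]]; exists f.{d}; first exact: hI.
by exists g.{d}; [apply: hJ | rewrite raddfD].
Qed.

(** In an ideal generated by forms of the same degree, the coefficients of a
    form can be taken to be forms. *)
Lemma ideal_gen_formP (S : set {mpoly K[n]}) e d f :
  (forall g, S g -> g \is e.-form) -> ideal_gen S f -> f \is (d + e).-form ->
  exists2 s : seq ({mpoly K[n]} * {mpoly K[n]}),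
    forall u, u \in s -> u.1 \is d.-form /\ S u.2 & f = \sum_(u <- s) u.1 * u.2.
Proof.
move=> Se [s sS fs] fd; exists [seq (u.1.{d}, u.2) | u <- s].
  by move=> _ /mapP[u us ->] /=; split; [apply: pihomogP | apply: sS].
rewrite -[LHS](pihomog_dE fd) fs raddf_sum big_map; apply: eq_big_seq => u us /=.
exact: homog_compM_form (Se _ (sS _ us)).
Qed.

Lemma ideal_gen_form_lt (S : set {mpoly K[n]}) e d f :
  (forall g, S g -> g \is e.-form) -> ideal_gen S f -> f \is d.-form -> (d < e)%N ->
  f = 0.
Proof.
move=> Se [s sS fs] fd lt_de; rewrite -[LHS](pihomog_dE fd) fs raddf_sum.
rewrite big_seq big1 // => u us /=; exact: homog_compM_form_lt (Se _ (sS _ us)) _.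
Qed.

End Components.

(** * Linear substitutions *)

Section LinearSubstitution.
Variable K : fieldType.

Lemma linformE a b (B : 'M[K]_(a, b)) i : linform B i = \sum_(j < b) B i j *: 'X_j.
Proof. by []. Qed.

Lemma linform_form a b (B : 'M[K]_(a, b)) i : linform B i \is 1.-form.
Proof. by apply: rpred_sum => j _; apply: rpredZ; rewrite dhomogX; apply/eqP/mdeg1. Qed.

Lemma meval_linform a b (B : 'M[K]_(a, b)) i v :
  (linform B i).@[v] = \sum_(j < b) B i j * v j.
Proof. by rewrite raddf_sum; apply: eq_bigr => j _; rewrite /= mevalZ mevalXU. Qed.

Definition lsub a b (B : 'M[K]_(a, b)) : {mpoly K[a]} -> {mpoly K[b]} :=
  mmap (@mpolyC b K) (linform B).

HB.instance Definition _ a b (B : 'M[K]_(a, b)) := GRing.RMorphism.on (lsub B).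

Variables (a b : nat) (B : 'M[K]_(a, b)).

Lemma lsubC c : lsub B c%:MP = c%:MP.
Proof. by rewrite /lsub mmapC. Qed.

Lemma lsubX i : lsub B 'X_i = linform B i.
Proof. by rewrite /lsub mmapX mmap1U. Qed.

Lemma lsub_scalable : scalable (lsub B).
Proof. by move=> c f; rewrite -!mul_mpolyC rmorphM /= lsubC. Qed.

HB.instance Definition _ :=
  GRing.isScalable.Build K {mpoly K[a]} {mpoly K[b]} _ (lsub B) lsub_scalable.

Lemma lsub_linform (c : nat) (A : 'M[K]_(c, a)) s : lsub B (linform A s) = linform (A *m B) s.
Proof.
rewrite linear_sum /=.
under eq_bigr do rewrite linearZ /= lsubX scaler_sumr.
rewrite exchange_big; apply: eq_bigr => j _ /=; rewrite mxE scaler_suml.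
by apply: eq_bigr => i _; rewrite scalerA.
Qed.

Lemma lsub_form d f : f \is d.-form -> lsub B f \is d.-form.
Proof.
move=> fd; rewrite (mpolyE f) linear_sum /= big_seq; apply: rpred_sum => m.
move=> /(dhomog_mf fd) md; have {}md : mdeg m = d := md.
rewrite linearZ /=; apply: rpredZ; rewrite /lsub mmapX -md mdegE.
apply: (big_ind2 (fun p e => p \is e.-form)).
- exact: dhomog1.
- by move=> p e p' e' pe pe'; apply: dhomogM.
- by move=> i _; have := dhomogMn (m i) (linform_form B i); rewrite mul1n.
Qed.

Lemma lsub_comp d f : (lsub B f).{d} = lsub B f.{d}.
Proof.
pose k := maxn (msize f) d.+1.
have -> : lsub B f = \sum_(0 <= i < k) lsub B f.{i}.
  by rewrite -linear_sum -homog_components // leq_maxl.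
rewrite raddf_sum; have dk : (d < k)%N by rewrite leq_max leqnn orbT.
rewrite big_mkord (bigD1 (Ordinal dk)) //= big1 ?addr0 => [|i ni].
  by rewrite pihomog_dE //; apply/lsub_form/pihomogP.
rewrite (homog_comp_formE _ (lsub_form (pihomogP _ i f))); case: eqP => // id.
by case/eqP: ni; apply: val_inj.
Qed.

Lemma meval_lsub f v :
  (lsub B f).@[v] = f.@[fun i => \sum_(j < b) B i j * v j].
Proof.
apply: (mpoly_morph_ext (f := meval v \o lsub B) (g := meval _)) => [c|i] /=.
  by rewrite lsubC !mevalC.
by rewrite lsubX mevalXU meval_linform.
Qed.

End LinearSubstitution.

Lemma lsub_lsub (K : fieldType) a b c (B : 'M[K]_(a, b)) (C : 'M[K]_(b, c)) f :
  lsub C (lsub B f) = lsub (B *m C) f.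
Proof.
apply: (mpoly_morph_ext (f := lsub C \o lsub B) (g := lsub _)) => [x|i] /=.
  by rewrite !lsubC.
by rewrite !lsubX lsub_linform.
Qed.

Lemma linform1 (K : fieldType) a (i : 'I_a) : linform (1%:M : 'M[K]_a) i = 'X_i.
Proof.
rewrite linformE (bigD1 i) //= mxE eqxx scale1r big1 ?addr0 // => j ji.
by rewrite mxE eq_sym (negbTE ji) scale0r.
Qed.

Lemma lsub1 (K : fieldType) a (f : {mpoly K[a]}) : lsub 1%:M f = f.
Proof.
apply: (mpoly_morph_ext (f := lsub 1%:M) (g := idfun)) => [x|i] /=.
  by rewrite lsubC.
by rewrite lsubX linform1.
Qed.

(** * Hilbert functions *)

Lemma dhomog_form (n : nat) (K : fieldType) d (f : dhomog n K d) :
  mpoly_of_dhomog f \is d.-form.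
Proof. exact: dhomog_is_dhomog. Qed.

Section HilbertFunction.
Variables (n : nat) (K : fieldType).
Implicit Types (J : set {mpoly K[n.+1]}) (d : nat).

Definition hproj d (f : {mpoly K[n.+1]}) : dhomog n.+1 K d :=
  DHomog (pihomogP mdeg d f).

Lemma hproj_linear d : linear (@hproj d).
Proof. by move=> c f g; apply: val_inj; rewrite /= linearP. Qed.

HB.instance Definition _ d :=
  GRing.isLinear.Build K {mpoly K[n.+1]} (dhomog n.+1 K d) _ (@hproj d)
    (@hproj_linear d).

Lemma hprojK d (f : dhomog n.+1 K d) : hproj d f = f.
Proof. by apply: val_inj; rewrite /= pihomog_dE // dhomog_form. Qed.

Lemma dim_forms d : \dim {: dhomog n.+1 K d} = 'C(d + n, d).
Proof. by rewrite dimvf. Qed.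

Lemma mem_hspace J d (f : dhomog n.+1 K d) :
  is_ideal J -> (f \in hspace J d) = `[< J f >].
Proof. by move=> idJ; apply/idP/asboolP => /(hspaceP idJ). Qed.

Lemma hspaceS J J' d : is_ideal J -> is_ideal J' ->
  (forall f, f \is d.-form -> J f -> J' f) -> (hspace J d <= hspace J' d)%VS.
Proof.
move=> idJ idJ' sJ; apply/subvP => f; rewrite !mem_hspace //.
by move=> /asboolP Jf; apply/asboolP/sJ => //; apply: dhomog_form.
Qed.

Lemma hilbert_funK J d :
  (hilbert_fun J d + \dim (hspace J d))%N = \dim {: dhomog n.+1 K d}.
Proof. by rewrite subnK // dimvS ?subvf. Qed.

End HilbertFunction.

(** The linear map between spaces of forms induced by a linear map [phi] of
    polynomials; the projection matters only if [phi] is not homogeneous. *)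
Definition hmap (n n' : nat) (K : fieldType)
    (phi : {linear {mpoly K[n.+1]} -> {mpoly K[n'.+1]}}) (d d' : nat) :
    'Hom(dhomog n.+1 K d, dhomog n'.+1 K d') :=
  linfun (@hproj n' K d' \o phi \o @mpoly_of_dhomog n.+1 K d).

Lemma hmapE (n n' : nat) (K : fieldType)
    (phi : {linear {mpoly K[n.+1]} -> {mpoly K[n'.+1]}}) d d' f :
  hmap phi d d' f = hproj d' (phi f).
Proof. by rewrite lfunE. Qed.

Definition mulp (n : nat) (K : fieldType) (g f : {mpoly K[n]}) := g * f.

Lemma mulp_linear (n : nat) (K : fieldType) (g : {mpoly K[n]}) : linear (mulp g).
Proof. by move=> c f h; rewrite /mulp mulrDr scalerAr. Qed.

HB.instance Definition _ (n : nat) (K : fieldType) (g : {mpoly K[n]}) :=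
  GRing.isLinear.Build K {mpoly K[n]} {mpoly K[n]} _ (mulp g) (mulp_linear g).

Lemma hmap_mulpE (n : nat) (K : fieldType) (g : {mpoly K[n.+1]}) e d
    (f : dhomog n.+1 K d) :
  g \is e.-form -> hmap (mulp g) d (e + d)%N f = g * f :> {mpoly K[n.+1]}.
Proof. by move=> ge; rewrite hmapE /= pihomog_dE // dhomogM // dhomog_form. Qed.

Lemma hmap_mulp_ker (n : nat) (K : fieldType) (g : {mpoly K[n.+1]}) e d :
  g \is e.-form -> g != 0 -> lker (hmap (mulp g) d (e + d)%N) == 0%VS.
Proof.
move=> ge g0; rewrite -subv0; apply/subvP => f.
rewrite memv_ker memv0 => /eqP /(congr1 val) /=; rewrite hmap_mulpE //.
by move=> /eqP; rewrite mulf_eq0 (negbTE g0).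
Qed.

Section LinearSections.
Variables (n : nat) (K : fieldType).
Implicit Types (I : set {mpoly K[n.+1]}) (d r : nat).

Lemma linforms_idealP N r (A : 'M[K]_(r, N)) f :
  linforms_ideal A f <->
  exists q : 'I_r -> {mpoly K[N]}, f = \sum_s q s * linform A s.
Proof.
split=> [[s sA ->]|[q ->]]; last first.
  apply: ideal_sumP => [|s _]; first exact: ideal_gen_is_ideal.
  have [_ _ JM] := ideal_gen_is_ideal (range (linform A)).
  by apply: JM; apply: mem_ideal_gen; exists s.
elim: s sA => [_|[u v] s IH sA].
  by exists (fun=> 0); rewrite big_nil big1 // => s _; rewrite mul0r.
have [|q qs] := IH; first by move=> w ws; apply: sA; rewrite inE ws orbT.
have [t _ /= tv] := sA (u, v) (mem_head _ _).
exists (fun s => q s + (if s == t then u else 0)).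
rewrite big_cons qs /= addrC -tv.
under [RHS]eq_bigr do rewrite mulrDl.
rewrite big_split /=; congr (_ + _).
by rewrite (bigD1 t) //= eqxx big1 ?addr0 // => i /negbTE ->; rewrite mul0r.
Qed.

Lemma linforms_ideal_homog N r (A : 'M[K]_(r, N)) :
  homogeneous_ideal (linforms_ideal A).
Proof.
by apply: ideal_gen_homog => _ [s _ <-]; exists 1%N; apply: linform_form.
Qed.

Lemma section_homog I r (A : 'M[K]_(r, n.+1)) :
  homogeneous_ideal I -> homogeneous_ideal (ideal_sum I (linforms_ideal A)).
Proof. by move=> hI; apply: ideal_sum_homog => //; apply: linforms_ideal_homog. Qed.

(** In degree [d.+1] the larger ideal consists of the smaller one and of the
    multiples of the extra linear form. As the multiples by members of the
    smaller ideal are already there, the factors can be taken in a complement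
    of its part of degree [d]. *)
Lemma hilbert_fun_section I r (A : 'M[K]_(r.+1, n.+1)) d :
  homogeneous_ideal I ->
  (hilbert_fun (ideal_sum I (linforms_ideal (row' ord0 A))) d.+1 <=
   hilbert_fun (ideal_sum I (linforms_ideal (row' ord0 A))) d +
   hilbert_fun (ideal_sum I (linforms_ideal A)) d.+1)%N.
Proof.
move=> hI; set J := ideal_sum I _; set J' := ideal_sum I _.
have hJ : homogeneous_ideal J by apply: section_homog.
have hJ' : homogeneous_ideal J' by apply: section_homog.
have [[[J0 JD JM] Jh] [[J'0 J'D J'M] J'h]] := (hJ, hJ').
pose L := linform A ord0; pose mL := hmap (mulp L) d d.+1.
pose C := ((hspace J d)^C)%VS.
have LE (f : dhomog n.+1 K d) : mL f = L * f :> {mpoly K[n.+1]}.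
  exact: (hmap_mulpE (e := 1) _ (linform_form _ _)).
have sub : (hspace J' d.+1 <= hspace J d.+1 + mL @: C)%VS.
  apply/subvP => f; rewrite mem_hspace ?(proj1 hJ') // => /asboolP [g Ig [h]].
  move=> /linforms_idealP [q hq] ghf.
  pose h0 := \sum_(s < r) q (lift ord0 s) * linform (row' ord0 A) s.
  have hE : h = q ord0 * L + h0.
    rewrite hq big_ord_recl; congr (_ + _); apply: eq_bigr => s _; congr (_ * _).
    by apply: eq_bigr => j _; rewrite !mxE.
  have Jgh : J (g + h0).
    by exists g => //; exists h0 => //; apply/linforms_idealP; eexists.
  have -> : f = hproj d.+1 (g + h0) + mL (hproj d (q ord0)).
    apply: val_inj; rewrite /= LE /= mulrC.
    rewrite -(homog_compM_form _ _ (linform_form _ _)) addn1 -linearD /=.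
    by rewrite -addrA [h0 + _]addrC -hE ghf pihomog_dE // dhomog_form.
  have /memv_addP [u uJ [c cC ->]] : hproj d (q ord0) \in (hspace J d + C)%VS.
    by rewrite addv_complf memvf.
  rewrite [mL _]linearD addrA memv_add ?memv_img // mem_hspace ?(proj1 hJ) //.
  apply/asboolP; rewrite linearD /= LE; apply: JD; first exact: Jh.
  by apply: JM; apply/(hspaceP (proj1 hJ)).
have dimC : \dim C = hilbert_fun J d by rewrite dimv_compl.
have dimJ' := leq_trans (dimvS sub) (dimv_add_leqif _ _).
have /eq_leq dimLC := limg_ker_dim mL C.
rewrite -(leq_add2r (\dim (hspace J d.+1))) hilbert_funK -(hilbert_funK J' d.+1).
rewrite [X in (_ <= X + _)%N]addnC -addnA leq_add2l.
apply: leq_trans dimJ' _; rewrite addnC leq_add2r -dimC.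
by apply: leq_trans dimLC; apply: leq_addl.
Qed.

End LinearSections.

(** * Generic properties *)

Section Zariski.
Variables (K : fieldType) (charK0 : [pchar K] =i pred0).
Local Open Scope classical_set_scope.

Lemma basic_open N (g : {mpoly K[N]}) :
  zariski_open [set v : 'rV[K]_N | g.@[v 0] != 0].
Proof. by exists [set g]; apply/seteqP; split=> v; [exists g | case=> _ ->]. Qed.

(** A nonempty open set that a line meets contains all but finitely many of the
    points of the line. *)
Lemma zariski_open_line N (U : set 'rV[K]_N) v w t0 :
  zariski_open U -> U (v + t0 *: w) ->
  exists2 p : {poly K}, p != 0 & forall t, p.[t] != 0 -> U (v + t *: w).
Proof.
move=> [S ->] [g Sg gv].
pose p := mmap polyC (fun i => (v 0 i)%:P + (w 0 i)%:P * 'X) g.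
have pE t : p.[t] = g.@[(v + t *: w) 0].
  apply: (mpoly_morph_ext (f := horner_eval t \o mmap polyC _) (g := meval _)).
    by move=> c /=; rewrite mmapC mevalC /horner_eval hornerC.
  move=> i /=; rewrite mmapX mmap1U mevalXU /horner_eval !hornerE.
  by rewrite !mxE mulrC.
exists p; last by move=> t; rewrite pE; exists g.
by apply: contra_neq gv => p0; rewrite -pE p0 horner0.
Qed.

(** The line through a point of each set meets both in all but finitely many of
    its points. *)
Lemma zariski_openI N (U V : set 'rV[K]_N) :
  zariski_open U -> zariski_open V -> U !=set0 -> V !=set0 ->
  zariski_open (U `&` V) /\ U `&` V !=set0.
Proof.
move=> oU oV [u Uu] [v Vv]; split.
  have [S ->] := oU; have [T ->] := oV.
  exists [set f * g | f in S & g in T]; apply/seteqP.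
  split=> [x []|x [_ [f Sf [g Tg <-]]]].
    move=> [f Sf fx] [g Tg gx]; exists (f * g); last by rewrite mevalM mulf_neq0.
    by exists f => //; exists g.
  by rewrite mevalM mulf_eq0 negb_or => /andP[fx gx]; split; [exists f | exists g].
have [|p p0 pU] := @zariski_open_line N U u (v - u) 0 oU; first by rewrite scale0r addr0.
have [|q q0 qV] := @zariski_open_line N V u (v - u) 1 oV.
  by rewrite scale1r addrC subrK.
have [t] := poly_nonroot charK0 (mulf_neq0 p0 q0).
rewrite hornerM mulf_eq0 negb_or => /andP[pt qt].
by exists (u + t *: (v - u)); split; [apply: pU | apply: qV].
Qed.

(** Linear forms can be chosen to be generic together with all but the first of
    them. *)
Lemma zariski_open_row' r N (U : set 'rV[K]_(r * N)) (V : set 'rV[K]_(r.+1 * N)) :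
  zariski_open U -> zariski_open V -> U !=set0 -> V !=set0 ->
  exists2 A : 'M[K]_(r.+1, N), U (mxvec (row' ord0 A)) & V (mxvec A).
Proof.
move=> oU oV [u Uu] [v Vv].
pose A0 : 'M[K]_(r.+1, N) := col_mx (0 : 'M_(1, N)) (vec_mx u).
have A0E : row' ord0 A0 = vec_mx u.
  apply/matrixP => i j; rewrite mxE mxE; case: splitP => [k|k /= ik].
    by rewrite (ord1 k).
  by congr (vec_mx u _ _); apply: val_inj; case: ik.
pose W := vec_mx v - A0.
have row'D t : row' ord0 (A0 + t *: W) = row' ord0 A0 + t *: row' ord0 W.
  by apply/matrixP => i j; rewrite !mxE.
have [|p p0 pU] := @zariski_open_line _ U u (mxvec (row' ord0 W)) 0 oU.
  by rewrite scale0r addr0.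
have [|q q0 qV] := @zariski_open_line _ V (mxvec A0) (mxvec W) 1 oV.
  by rewrite scale1r -linearD /= addrC subrK vec_mxK.
have [t] := poly_nonroot charK0 (mulf_neq0 p0 q0).
rewrite hornerM mulf_eq0 negb_or => /andP[/pU Ut /qV Vt].
exists (A0 + t *: W); last by rewrite linearD linearZ.
by rewrite row'D A0E linearD linearZ /= vec_mxK.
Qed.

(** A right inverse [X] of the matrix at [v0] singles out one combination of
    maximal minors, [det (M *m X)], that does not vanish at [v0]. *)
Lemma row_free_open N r s (M : 'M[{mpoly K[N]}]_(r, s)) (v0 : 'rV[K]_N) :
  row_free (map_mx (meval (v0 0)) M) ->
  exists U : set 'rV[K]_N, [/\ zariski_open U, U v0 &
    forall v, U v -> row_free (map_mx (meval (v 0)) M)].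
Proof.
case/row_freeP => X MX; pose g := \det (M *m map_mx (@mpolyC N K) X).
have gE v : g.@[v 0] = \det (map_mx (meval (v 0)) M *m X).
  rewrite /g -det_map_mx map_mxM; congr (\det (_ *m _)).
  by apply/matrixP => i j; rewrite !mxE /= mevalC.
exists [set v | g.@[v 0] != 0]; split; first exact: basic_open.
  by rewrite /= gE MX det1 oner_neq0.
move=> v /=; rewrite gE -unitfE -unitmxE -row_free_unit => MXfree.
rewrite -row_leq_rank; apply: leq_trans (mxrankM_maxl _ X).
by rewrite row_leq_rank.
Qed.

End Zariski.

Section Semicontinuity.
Variables (K : fieldType) (charK0 : [pchar K] =i pred0) (n : nat).
Variables (I : set {mpoly K[n.+1]}) (homI : homogeneous_ideal I).
Local Open Scope classical_set_scope.

(** A basis of the forms of degree [d] of the section by [A0] extends to a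
    family of forms in the sections by the other [A] whose coefficients are
    affine functions of [A]; it remains free on an open set. *)
Lemma hilbert_fun_semicontinuous r (A0 : 'M[K]_(r, n.+1)) d :
  exists U : set 'rV[K]_(r * n.+1), [/\ zariski_open U, U (mxvec A0) &
    forall A, U (mxvec A) -> (hilbert_fun (ideal_sum I (linforms_ideal A)) d <=
      hilbert_fun (ideal_sum I (linforms_ideal A0)) d)%N].
Proof.
pose J (A : 'M[K]_(r, n.+1)) := ideal_sum I (linforms_ideal A).
have hJ A : homogeneous_ideal (J A) by apply: section_homog.
pose b0 := vbasis (hspace (J A0) d); set m := \dim _ in b0.
have decomp j : exists c : {mpoly K[n.+1]} * ('I_r -> {mpoly K[n.+1]}),
    I c.1 /\ tnth b0 j = c.1 + \sum_s c.2 s * linform A0 s :> {mpoly K[n.+1]}.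
  have : tnth b0 j \in hspace (J A0) d by apply/vbasis_mem/mem_tnth.
  move=> /(hspaceP (proj1 (hJ A0))) [g Ig [_ /linforms_idealP [q ->] jE]].
  by exists (g, q).
pose c j := sval (cid (decomp j)).
have cE j : I (c j).1 /\
    tnth b0 j = (c j).1 + \sum_s (c j).2 s * linform A0 s :> {mpoly K[n.+1]}.
  by rewrite /c; case: cid.
pose b (A : 'M[K]_(r, n.+1)) j : dhomog n.+1 K d := hproj d (c j).1 +
  \sum_s \sum_k A s k *: hproj d ((c j).2 s * 'X_k).
have bE A j : b A j = hproj d ((c j).1 + \sum_s (c j).2 s * linform A s).
  rewrite linearD linear_sum; congr (_ + _); apply: eq_bigr => s _.
  rewrite mulr_sumr linear_sum; apply: eq_bigr => k _.
  by rewrite -scalerAr linearZ.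
have bJ A j : b A j \in hspace (J A) d.
  apply/(hspaceP (proj1 (hJ A))); rewrite bE /=; apply: (proj2 (hJ A)).
  exists (c j).1; first by case: (cE j).
  by exists (\sum_s (c j).2 s * linform A s) => //; apply/linforms_idealP; eexists.
have b0E j : b A0 j = tnth b0 j.
  by rewrite bE; have [_ <-] := cE j; rewrite hprojK.
pose D := \dim {: dhomog n.+1 K d}; pose e := vbasis {: dhomog n.+1 K d}.
pose M : 'M[{mpoly K[r * n.+1]}]_(m, D) := \matrix_(j, l)
  ((coord e l (hproj d (c j).1))%:MP +
   \sum_s \sum_k (coord e l (hproj d ((c j).2 s * 'X_k))) *: 'X_(mxvec_index s k)).
have ME A : map_mx (meval (mxvec A 0)) M = \matrix_(j, l) coord e l (b A j).
  apply/matrixP => j l; rewrite !mxE mevalD mevalC raddf_sum [RHS]linearD [in RHS]linear_sum.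
  congr (_ + _); apply: eq_bigr => s _ /=; rewrite raddf_sum [RHS]linear_sum.
  apply: eq_bigr => k _ /=; rewrite mevalZ mevalXU mxvecE [RHS]linearZ /=.
  by rewrite mulrC.
have row_freeE A : row_free (\matrix_(j, l) coord e l (b A j)) <->
    free [tuple b A j | j < m].
  have coordE (k : 'I_m -> K) : (\row_j k j) *m (\matrix_(j, l) coord e l (b A j)) =
      \row_l coord e l (\sum_j k j *: b A j).
    apply/rowP => l; rewrite !mxE linear_sum; apply: eq_bigr => j _.
    by rewrite !mxE /= linearZ.
  have nthE (k : 'I_m -> K) :
      \sum_(j < m) k j *: [tuple b A j | j < m]`_j = \sum_j k j *: b A j.
    by apply: eq_bigr => j _; rewrite nth_mktuple.
  split=> [Mfree|/freeP bfree].
    apply/freeP => k; rewrite nthE => k0 j.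
    have /eqP : (\row_j k j) *m (\matrix_(j, l) coord e l (b A j)) = 0.
      by rewrite coordE k0; apply/rowP => l; rewrite !mxE linear0.
    by rewrite mulmx_free_eq0 // => /eqP /rowP /(_ j); rewrite !mxE.
  apply: inj_row_free => v; have -> : v = \row_j v 0 j by apply/rowP => j; rewrite mxE.
  rewrite coordE => /rowP v0; apply/rowP => j; rewrite !mxE.
  apply: (bfree (fun j => v 0 j)); rewrite nthE.
  rewrite (coord_vbasis (memvf (\sum_(j < m) v 0 j *: b A j))) big1 // => l _.
  by have := v0 l; rewrite !mxE => ->; rewrite scale0r.
have [|U [oU UA0 UM]] := @row_free_open K (r * n.+1) m D M (mxvec A0).
  rewrite ME; apply/row_freeE.
  have -> : [tuple b A0 j | j < m] = b0.
    by apply: eq_from_tnth => j; rewrite tnth_mktuple b0E.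
  exact: basis_free (vbasisP _).
exists U; split=> // A /UM; rewrite ME => /row_freeE bfree.
apply: leq_sub2l; apply: (@leq_trans (\dim <<[tuple b A j | j < m]>>)).
  by rewrite (eqP bfree) size_tuple.
apply: dimvS; apply/span_subvP => f /tnthP [j ->].
by rewrite tnth_mktuple bJ.
Qed.

(** By semicontinuity, the generic value is the least one. *)
Lemma generic_section_valueP r d : exists m, generic_section_value I r d m.
Proof.
pose Q m := `[< exists A : 'M[K]_(r, n.+1),
  hilbert_fun (ideal_sum I (linforms_ideal A)) d = m >].
have ex : exists m, Q m.
  exists (hilbert_fun (ideal_sum I (linforms_ideal (0 : 'M_(r, n.+1)))) d).
  by apply/asboolP; eexists.
case: (ex_minnP ex) => m /asboolP [A0 A0m] mmin; exists m.
have [U [oU UA0 Ule]] := hilbert_fun_semicontinuous A0 d.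
exists U; split=> // [|A /Ule]; first by exists (mxvec A0).
rewrite A0m => le; apply/eqP; rewrite eqn_leq le mmin //.
by apply/asboolP; exists A.
Qed.

Lemma sectional_matrixP i d :
  generic_section_value I (n.+1 - i) d (sectional_matrix I i d).
Proof.
apply: (@xgetPex _ 0%N [set m | generic_section_value I (n.+1 - i) d m]).
exact: generic_section_valueP.
Qed.

Lemma generic_section_value_growth r d m1 m2 m3 :
  generic_section_value I r d.+1 m1 -> generic_section_value I r d m2 ->
  generic_section_value I r.+1 d.+1 m3 -> (m1 <= m2 + m3)%N.
Proof.
move=> [U [oU U0 Um]] [V [oV V0 Vm]] [W [oW W0 Wm]].
have [oUV UV0] := zariski_openI charK0 oU oV U0 V0.
have [A [UA VA] WA] := zariski_open_row' charK0 oUV oW UV0 W0.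
by rewrite -(Um _ UA) -(Vm _ VA) -(Wm _ WA); apply: hilbert_fun_section.
Qed.

(** The growth inequalities for [3, ..., i] bound the entry [(i, d.+1)] by the
    entries [(3, d), ..., (i, d)] and [(2, d.+1)]; when it is the sum of all
    entries of degree [d], the entries [(1, d)] and [(2, d)] are left. *)
Lemma maximal_growth2 i d : (2 <= i <= n.+1)%N -> maximal_growth I i d ->
  (sectional_matrix I 2 d <= sectional_matrix I 2 d.+1)%N.
Proof.
move=> /andP[i2 iN]; rewrite /maximal_growth.
have step j : (2 <= j)%N -> (j < n.+1)%N -> (sectional_matrix I j.+1 d.+1 <=
    sectional_matrix I j.+1 d + sectional_matrix I j d.+1)%N.
  move=> j2 jn; apply: generic_section_value_growth; try exact: sectional_matrixP.
  by rewrite -subSn // subSS; apply: sectional_matrixP.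
have i1 : (1 < i.+1)%N by rewrite ltnS ltnW.
rewrite (big_ltn i1) (@big_ltn _ _ _ 2) // => growth.
suff : (sectional_matrix I i d.+1 <=
    \sum_(3 <= j < i.+1) sectional_matrix I j d + sectional_matrix I 2 d.+1)%N.
  by rewrite growth; lia.
elim: i i2 iN {growth i1} => // i IH; rewrite leq_eqVlt => /predU1P [<- _|i2 iN].
  by rewrite big_geq.
rewrite big_nat_recr //=.
have := step _ i2 iN; have := IH i2 (ltnW iN); lia.
Qed.

End Semicontinuity.

(** * Plane sections *)

Section Planes.
Variables (K : fieldType) (n : nat).
Implicit Types (A : 'M[K]_(n, n.+2)) (B : 'M[K]_(n.+2, 2)).
Local Open Scope classical_set_scope.

(** The rows of [A] are independent equations of the plane spanned by the two
    independent columns of [B]. *)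
Definition plane A B : Prop :=
  [/\ A *m B = 0, (kermx B <= A)%MS & exists C : 'M[K]_(2, n.+2), C *m B = 1%:M].

Lemma row_free_basis r N m (M : 'M[K]_(m, N)) : \rank M = r ->
  exists2 X : 'M[K]_(r, N), row_free X & (X :=: M)%MS.
Proof. by move=> <-; exists (row_base M); [apply: row_base_free | apply: eq_row_base]. Qed.

Lemma plane_spanned A : row_free A -> exists B, plane A B.
Proof.
move=> Afree; have rA : \rank A = n by apply/eqP.
have [|X /row_freeP [Y XY] eqX] := @row_free_basis 2 _ _ (kermx A^T).
  by rewrite mxrank_ker mxrank_tr rA -addn2 addKn.
have AX : A *m X^T = 0.
  by apply: trmx_inj; rewrite trmx_mul trmxK trmx0; apply/sub_kermxP; rewrite eqX.
have YX : Y^T *m X^T = 1%:M by rewrite -trmx_mul XY trmx1.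
exists X^T; split=> //; last by exists Y^T.
have AkX : (A <= kermx X^T)%MS by apply/sub_kermxP.
have rX : \rank X^T = 2.
  by apply/eqP; rewrite mxrank_tr; apply/row_freeP; exists Y.
rewrite -(geq_leqif (mxrank_leqif_sup AkX)) mxrank_ker rX rA -addn2 addnK //.
Qed.

Lemma plane_equations B (C : 'M[K]_(2, n.+2)) : C *m B = 1%:M ->
  exists A, plane A B.
Proof.
move=> CB; have rB : \rank B = 2.
  apply/eqP; rewrite -mxrank_tr; apply/row_freeP; exists C^T.
  by rewrite -trmx_mul CB trmx1.
have [|A _ eqA] := @row_free_basis n _ _ (kermx B).
  by rewrite mxrank_ker rB -addn2 addnK.
exists A => //; split; last by exists C.
  by apply/sub_kermxP; rewrite eqA.
by rewrite eqA.
Qed.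

Variables (A : 'M[K]_(n, n.+2)) (B : 'M[K]_(n.+2, 2)) (AB : plane A B).

Lemma lsub_linforms_ideal f : linforms_ideal A f -> lsub B f = 0.
Proof.
have [AB0 _ _] := AB.
move=> /linforms_idealP [q ->]; rewrite rmorph_sum big1 // => s _.
rewrite rmorphM /= lsub_linform AB0 [linform _ _]big1 ?mulr0 // => j _.
by rewrite mxE scale0r.
Qed.

Lemma lsub_surj g : exists f, lsub B f = g.
Proof.
by have [_ _ [C CB]] := AB; exists (lsub C g); rewrite lsub_lsub CB lsub1.
Qed.

(** Modulo the equations of the plane, the variables are equal to their
    restrictions pulled back to the space along a linear projection. *)
Lemma lsub_ker f : lsub B f = 0 -> linforms_ideal A f.
Proof.
have [AB0 kA [C CB]] := AB; have [idT _] := linforms_ideal_homog A.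
have [T0 TD TM] := idT; pose s := lsub (B *m C).
suff sT g : linforms_ideal A (g - s g).
  by move=> f0; have := sT f; rewrite /s -lsub_lsub f0 rmorph0 subr0.
have sM a b : linforms_ideal A (a - s a) -> linforms_ideal A (b - s b) ->
    linforms_ideal A (a * b - s (a * b)).
  have -> : s (a * b) = s a * s b by apply: rmorphM.
  move=> Ta Tb; rewrite (_ : _ - _ = a * (b - s b) + s b * (a - s a)).
    by apply: TD; apply: TM.
  by rewrite !mulrBr addrA [s b * a]mulrC subrK [s b * s a]mulrC.
have sX i : linforms_ideal A ('X_i - s 'X_i).
  have /submxP [Y YA] : (1%:M - B *m C <= A)%MS.
    have BCk : (1%:M - B *m C <= kermx B)%MS.
      by apply/sub_kermxP; rewrite mulmxBl mul1mx -mulmxA CB mulmx1 subrr.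
    by apply: submx_trans BCk kA.
  rewrite /s lsubX -linform1.
  have -> : linform 1%:M i - linform (B *m C) i = \sum_k (Y i k)%:MP * linform A k.
    rewrite !linformE -sumrB.
    under eq_bigr => j _ do rewrite -scalerBl.
    under [RHS]eq_bigr => k _ do rewrite mul_mpolyC linformE scaler_sumr.
    rewrite exchange_big; apply: eq_bigr => j _ /=.
    have /matrixP /(_ i j) := YA; rewrite !mxE => ->; rewrite scaler_suml.
    by apply: eq_bigr => k _; rewrite scalerA.
  by apply/linforms_idealP; exists (fun k => (Y i k)%:MP).
rewrite (mpolyE g) /s rmorph_sum -sumrB; apply: ideal_sumP => // m _.
rewrite -mul_mpolyC; apply: (sM); first by rewrite /s lsubC subrr.
rewrite mpolyXE_id; apply: (big_ind (fun a => linforms_ideal A (a - s a))).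
- by rewrite /s rmorph1 subrr.
- exact: sM.
- move=> i _; elim: (m i) => [|k IH]; first by rewrite expr0 /s rmorph1 subrr.
  by rewrite exprS; apply: sM.
Qed.

Lemma lsub_image_ideal (I : set {mpoly K[n.+2]}) :
  homogeneous_ideal I -> homogeneous_ideal (lsub B @` I).
Proof.
move=> [[I0 ID IM] Ih]; split; last first.
  by move=> _ d [f If <-]; rewrite lsub_comp; exists f.{d} => //; apply: Ih.
split; first by exists 0 => //; rewrite rmorph0.
  move=> _ _ [f If <-] [g Ig <-]; exists (f + g); last by rewrite rmorphD.
  exact: ID.
move=> a _ [f If <-]; have [b <-] := lsub_surj a.
by exists (b * f); [apply: IM | rewrite rmorphM].
Qed.

Lemma lsub_image_gen (W : set {mpoly K[n.+2]}) :
  lsub B @` ideal_gen W = ideal_gen (lsub B @` W).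
Proof.
apply/seteqP; split=> [_ [_ [s sW ->] <-]|].
  rewrite rmorph_sum big_seq; apply: ideal_sumP => [|u us].
    exact: ideal_gen_is_ideal.
  rewrite rmorphM /=; have [_ _ JM] := ideal_gen_is_ideal (lsub B @` W).
  by apply/JM/mem_ideal_gen; exists u.2 => //; apply: sW.
have [W0 WD WM] := ideal_gen_is_ideal W.
apply: ideal_gen_sub.
  split; first by exists 0 => //; rewrite rmorph0.
    move=> _ _ [f If <-] [g Ig <-]; exists (f + g); last by rewrite rmorphD.
    exact: WD.
  move=> a _ [f If <-]; have [b <-] := lsub_surj a.
  by exists (b * f); [apply: WM | rewrite rmorphM].
by move=> _ [w Ww <-]; exists w => //; apply: mem_ideal_gen.
Qed.

(** Restriction to the plane is onto and its kernel is contained in the ideal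
    of the section. *)
Lemma hilbert_fun_plane (I : set {mpoly K[n.+2]}) d : homogeneous_ideal I ->
  hilbert_fun (ideal_sum I (linforms_ideal A)) d = hilbert_fun (lsub B @` I) d.
Proof.
move=> hI; have hJ := section_homog A hI; set J := ideal_sum I _ in hJ *.
have hI' := lsub_image_ideal hI; set I' := lsub B @` I in hI' *.
have [I0 _ _] := proj1 hI; have [T0 _ _] := proj1 (linforms_ideal_homog A).
pose pr := hmap (lsub B) d d.
have prE (f : dhomog n.+2 K d) : pr f = lsub B f :> {mpoly K[2]}.
  by rewrite hmapE /= pihomog_dE // lsub_form // dhomog_form.
have kerJ : (lker pr <= hspace J d)%VS.
  apply/subvP => f; rewrite memv_ker => /eqP /(congr1 val) /=; rewrite prE.
  move=> /lsub_ker Tf; apply/(hspaceP (proj1 hJ)).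
  by exists 0 => //; exists (mpoly_of_dhomog f) => //; rewrite add0r.
have imgJ : (pr @: hspace J d = hspace I' d)%VS.
  apply/eqP; rewrite eqEsubv; apply/andP; split; apply/subvP => g.
    move=> /memv_imgP [f /(hspaceP (proj1 hJ)) [a Ia [t Tt atf]] ->].
    apply/(hspaceP (proj1 hI')); rewrite prE -atf; exists a => //.
    by rewrite rmorphD /= (lsub_linforms_ideal Tt) addr0.
  move=> /(hspaceP (proj1 hI')) [f If fg]; have -> : g = pr (hproj d f).
    by apply: val_inj; rewrite /= prE /= -lsub_comp fg pihomog_dE // dhomog_form.
  apply: memv_img; apply/(hspaceP (proj1 hJ)).
  by exists f.{d}; [apply: (proj2 hI) | exists 0 => //; rewrite addr0].
have imgT : (pr @: fullv = fullv)%VS.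
  apply/eqP; rewrite eqEsubv subvf; apply/subvP => g _.
  have [f fg] := lsub_surj g; have -> : g = pr (hproj d f).
    by apply: val_inj; rewrite /= prE /= -lsub_comp fg pihomog_dE // dhomog_form.
  exact/memv_img/memvf.
rewrite /hilbert_fun -(limg_ker_dim pr fullv) -(limg_ker_dim pr (hspace J d)).
by rewrite imgJ imgT capfv (capv_idPr kerJ) subnDl.
Qed.

End Planes.

(** * Ideals in two variables *)

Section TwoVariables.
Variable K : fieldType.
Local Notation S := {mpoly K[2]}.
Local Notation Y := ('X_(ord0 : 'I_2) : S).
Local Notation Z := ('X_(ord_max : 'I_2) : S).
Implicit Types (f g : S) (W : set S).

Lemma mdeg2 (m : 'X_{1..2}) : mdeg m = (m ord0 + m ord_max)%N.
Proof. by rewrite mdegE big_ord_recl big_ord1; congr (_ + m _)%N; apply: val_inj. Qed.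

Lemma mpolyX2 (m : 'X_{1..2}) : 'X_[m] = Y ^+ m ord0 * Z ^+ m ord_max.
Proof.
rewrite mpolyXE_id big_ord_recl big_ord1; congr (_ * _).
by have -> : lift ord0 ord0 = ord_max :> 'I_2 by apply: val_inj.
Qed.

Lemma form_X N (i : 'I_N) : ('X_i : {mpoly K[N]}) \is 1.-form.
Proof. by rewrite dhomogX; apply/eqP/mdeg1. Qed.

Lemma mpolyX_neq0 N (i : 'I_N) : ('X_i : {mpoly K[N]}) != 0.
Proof. by rewrite -msize_poly_eq0 msizeX. Qed.

Lemma form_X_exp N (i : 'I_N) k : ('X_i ^+ k : {mpoly K[N]}) \is k.-form.
Proof. by have := dhomogMn k (form_X i); rewrite mul1n. Qed.

Lemma form2_ind d (Q : S -> Prop) : Q 0 -> (forall f g, Q f -> Q g -> Q (f + g)) ->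
  (forall c a b, (a + b)%N = d -> Q (c *: (Y ^+ a * Z ^+ b))) ->
  forall f, f \is d.-form -> Q f.
Proof.
move=> Q0 QD QX f fd; rewrite (mpolyE f) big_seq; apply: big_ind => // m mf.
by rewrite mpolyX2; apply: QX; rewrite -mdeg2; apply: (dhomog_mf fd).
Qed.

Lemma form2_split d f : f \is d.+1.-form ->
  exists a b, [/\ a \is d.-form, b \is d.-form & f = Y * a + Z * b].
Proof.
move: f; apply: form2_ind.
- by exists 0, 0; rewrite !mulr0 addr0; split=> //; apply: rpred0.
- move=> _ _ [a [b [ad bd ->]]] [a' [b' [ad' bd' ->]]].
  by exists (a + a'), (b + b'); rewrite !mulrDr addrACA; split=> //; apply: rpredD.
- move=> c [|a] b abd.
    exists 0, (c *: Z ^+ d); rewrite mulr0 add0r expr0 mul1r; split=> //.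
    + exact: rpred0.
    + by apply/rpredZ/form_X_exp.
    + by rewrite -scalerAr -exprS -abd.
  exists (c *: (Y ^+ a * Z ^+ b)), 0; rewrite mulr0 addr0; split=> //.
  + move: abd; rewrite addSn => -[<-]; apply: rpredZ.
    by apply: dhomogM; apply: form_X_exp.
  + exact: rpred0.
  + by rewrite -scalerAr mulrA -exprS.
Qed.

Lemma dim_forms2 d : \dim {: dhomog 2 K d} = d.+1.
Proof. by rewrite dim_forms addn1 binSn. Qed.

Section Generated.
Variables (m : nat) (W : set S) (Wm : forall f, W f -> f \is m.-form).
Local Notation J := (ideal_gen W).
Local Notation dimJ d := (\dim (hspace J d)).

Let idJ : is_ideal J := ideal_gen_is_ideal W.

(** [J_d.+2 = Y J_d.+1 + Z J_d.+1], and both summands contain [Y Z J_d]. *)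
Lemma hspace_concave d : (m <= d.+1)%N ->
  (dimJ d.+2 + dimJ d <= dimJ d.+1 + dimJ d.+1)%N.
Proof.
move=> md; have [J0 JD JM] := idJ.
pose mY := hmap (mulp Y) d.+1 d.+2; pose mZ := hmap (mulp Z) d.+1 d.+2.
pose mYZ := hmap (mulp (Y * Z)) d d.+2; pose H := hspace J d.+1.
have mYE (f : dhomog 2 K d.+1) : mY f = Y * f :> S by exact: hmap_mulpE (form_X _).
have mZE (f : dhomog 2 K d.+1) : mZ f = Z * f :> S by exact: hmap_mulpE (form_X _).
have formYZ : Y * Z \is 2.-form := dhomogM (form_X _) (form_X _).
have mYZE (f : dhomog 2 K d) : mYZ f = Y * Z * f :> S by exact: hmap_mulpE formYZ.
have dimY : \dim (mY @: H) = \dim H.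
  apply: limg_dim_eq; apply/eqP; rewrite -subv0.
  have /eqP -> : lker mY == 0%VS by exact: hmap_mulp_ker (form_X _) (mpolyX_neq0 _).
  by rewrite capv0.
have dimZ : \dim (mZ @: H) = \dim H.
  apply: limg_dim_eq; apply/eqP; rewrite -subv0.
  have /eqP -> : lker mZ == 0%VS by exact: hmap_mulp_ker (form_X _) (mpolyX_neq0 _).
  by rewrite capv0.
have dimYZ : \dim (mYZ @: hspace J d) = dimJ d.
  apply: limg_dim_eq; apply/eqP; rewrite -subv0.
  have /eqP -> : lker mYZ == 0%VS.
    by apply: hmap_mulp_ker formYZ _; rewrite mulf_neq0 // mpolyX_neq0.
  by rewrite capv0.
have capYZ : (mYZ @: hspace J d <= mY @: H :&: mZ @: H)%VS.
  apply/subvP => _ /memv_imgP [f /(hspaceP idJ) Jf ->]; apply/memv_capP.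
  have hE X : X \is 1.-form -> hproj d.+1 (X * f) = X * f :> S.
    by move=> X1; rewrite /= pihomog_dE //; exact: (dhomogM X1 (dhomog_form f)).
  split; [have -> : mYZ f = mY (hproj d.+1 (Z * f))
         | have -> : mYZ f = mZ (hproj d.+1 (Y * f))].
  - by apply: val_inj; rewrite /= mYZE mYE hE ?form_X // mulrA.
  - by apply/memv_img/(hspaceP idJ); rewrite hE ?form_X //; apply: JM.
  - by apply: val_inj; rewrite /= mYZE mZE hE ?form_X // mulrA [Z * Y]mulrC.
  - by apply/memv_img/(hspaceP idJ); rewrite hE ?form_X //; apply: JM.
have sumYZ : (hspace J d.+2 <= mY @: H + mZ @: H)%VS.
  apply/subvP => f /(hspaceP idJ) Jf.
  have [k dk] : exists k, d.+2 = (k.+1 + m)%N by exists (d.+1 - m)%N; lia.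
  have [|s sW fs] := ideal_gen_formP (d := k.+1) Wm Jf; first by rewrite -dk dhomog_form.
  pose Q (g : S) := exists a b, [/\ a \is (k + m).-form /\ J a,
    b \is (k + m).-form /\ J b & g = Y * a + Z * b].
  have : Q f.
    rewrite fs big_seq; apply: (big_ind Q).
    - exists 0, 0; rewrite !mulr0 addr0.
      by split=> //; split=> //; apply: rpred0.
    - move=> _ _ [a [b [[ad Ja] [bd Jb] ->]]] [a' [b' [[ad' Ja'] [bd' Jb'] ->]]].
      exists (a + a'), (b + b'); rewrite !mulrDr addrACA.
      by split=> //; split; [apply: rpredD | apply: JD | apply: rpredD | apply: JD].
    - move=> u /sW [/form2_split [a [b [ak bk ->]]] Wu].
      exists (a * u.2), (b * u.2); rewrite !mulrA -mulrDl; split=> //; split.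
      + by apply: dhomogM => //; apply: Wm.
      + exact/JM/mem_ideal_gen.
      + by apply: dhomogM => //; apply: Wm.
      + exact/JM/mem_ideal_gen.
  rewrite /Q (_ : (k + m)%N = d.+1); last by lia.
  move=> [a [b [[ad Ja] [bd Jb] fab]]].
  have -> : f = mY (DHomog ad) + mZ (DHomog bd).
    by apply: val_inj; rewrite /= mYE mZE.
  by apply: memv_add; apply/memv_img/(hspaceP idJ).
have := dimvS sumYZ; have := dimv_sum_cap (mY @: H) (mZ @: H); have := dimvS capYZ.
rewrite dimY dimZ dimYZ; rewrite -/H; move: (\dim _) (\dim _) (\dim _) (\dim _) (\dim _).
lia.
Qed.

(** By concavity the dimensions keep growing by at most one, while they must
    reach the dimension of the space of all forms. *)
Lemma hspace_full D : (forall f, f \is D.-form -> J f) ->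
  (dimJ m.+1 <= (dimJ m).+1)%N -> dimJ m = m.+1.
Proof.
move=> fullD grow.
have mD : (m <= D)%N.
  rewrite leqNgt; apply/negP => lt_Dm; have YD := form_X_exp (ord0 : 'I_2) D.
  have /eqP := ideal_gen_form_lt Wm (fullD _ YD) YD lt_Dm.
  by rewrite expf_eq0 (negbTE (mpolyX_neq0 _)) andbF.
have step i : (dimJ (m + i).+1 <= (dimJ (m + i)).+1)%N.
  elim: i => [|i IH]; first by rewrite addn0.
  have := @hspace_concave (m + i) _; rewrite addnS; move: IH; lia.
have bound i : (dimJ (m + i) <= dimJ m + i)%N.
  elim: i => [|i IH]; first by rewrite !addn0.
  by rewrite addnS; have := step i; lia.
have dimD : dimJ D = D.+1.
  rewrite -(dim_forms2 D); congr (\dim _); apply/eqP; rewrite eqEsubv subvf.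
  by apply/subvP => f _; apply/(hspaceP idJ)/fullD/dhomog_form.
have := bound (D - m)%N; rewrite subnKC // dimD.
have : (dimJ m <= m.+1)%N by rewrite -(dim_forms2 m) dimvS ?subvf.
lia.
Qed.

End Generated.

End TwoVariables.

(** * The greatest common divisor of a space of forms *)

Definition quotient_by (R : comNzRingType) (W : set R) (F : R) : set R :=
  [set q | W (q * F)]%classic.

Lemma ideal_gen_quotient (R : idomainType) (W : set R) (F x : R) : F != 0 ->
  (forall w, W w -> divides F w) -> ideal_gen W (x * F) ->
  ideal_gen (quotient_by W F) x.
Proof.
move=> F0 FW [s sW xF].
have [y Qy yF] : exists2 y, ideal_gen (quotient_by W F) y & x * F = y * F.
  have [Q0 QD QM] := ideal_gen_is_ideal (quotient_by W F).
  pose Q g := exists2 y, ideal_gen (quotient_by W F) y & g = y * F.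
  rewrite xF big_seq; apply: (big_ind Q).
  - by exists 0; rewrite ?mul0r.
  - move=> _ _ [y Qy ->] [z Qz ->].
    by exists (y + z); [apply: QD | rewrite mulrDl].
  - move=> u /sW Wu; have [q uq] := FW _ Wu; exists (u.1 * q).
      by apply/QM/mem_ideal_gen; rewrite /quotient_by /= -uq.
    by rewrite uq mulrA.
by rewrite (mulIf F0 yF).
Qed.

Section FormsGcd.
Variables (n : nat) (K : fieldType) (p : 'I_n.+1 -> K) (p0 : p ord0 != 0).
Local Notation P := {mpoly K[n.+1]}.
Variables (W : set P) (m : nat) (Wm : forall w, W w -> w \is m.-form).
Variables (f : P) (Wf : W f) (fp : f.@[p] != 0).

(** A content of [g] in the direction of [p] would give a factor of [f] that is
    constant along [p], and a form since [f] is one: its value at [p] is its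
    value at the origin, which is zero unless it is a constant. *)
Lemma along_factor_primitive g : divides g f -> primitive (along p g).
Proof.
move=> gf a ag; have f0 : f != 0 by apply: contraNneq fp => ->; rewrite meval0.
have [b fab] : divides (proj_along p a) f.
  apply: divides_trans gf; have [q gq] := ag; exists (unalong p q).
  by rewrite -[g](alongK p0) gq rmorphM /= unalongC.
have [||_ _ [i ai _]] := @form_factors n.+1 K m b (proj_along p a).
- by rewrite -fab.
- by rewrite -fab; apply: Wm.
have ap : (proj_along p a).@[p] != 0.
  by apply: contraNneq fp => ap; rewrite fab mevalM ap mulr0.
have ap0 : (proj_along p a).@[p] = (proj_along p a).@[fun=> 0].
  rewrite -(meval_proj_along p0 a 1 (fun=> 0)); apply: meval_eq => i'.
  by rewrite add0r mul1r.
have [i0|i0] := posnP i; last by move: ap; rewrite ap0 (form_meval0 ai) ?eqxx.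
have := ai; rewrite i0 => /form0_const; set c := _@_0 => ac.
have aC : a = c%:MP by apply: polyC_inj; rewrite -(along_proj p0 a) ac alongC.
exists (c^-1)%:MP; rewrite aC -mpolyCM mulVf //.
by move: ap; rewrite ac mevalC.
Qed.

(** The last property puts a nonzero polynomial free of the variable along [p]
    into the ideal of the quotients by [F]. Together with [f / F], which does
    not vanish at [p], it confines their common zeros to codimension two. *)
Lemma forms_gcd : exists (F : P) (c : {mpoly K[n]}),
  [/\ F != 0, is_gcd W F, c != 0 & ideal_gen W (proj_along p c * F)].
Proof.
have f0 : f != 0 by apply: contraNneq fp => ->; rewrite meval0.
have [W0 WD WM] := ideal_gen_is_ideal W.
pose J : set {poly {mpoly K[n]}} := [set g | ideal_gen W (unalong p g)]%classic.
have idJ : is_ideal J.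
  split; first by rewrite /J /= rmorph0.
    by move=> a b; rewrite /J /= rmorphD; apply: WD.
  by move=> a b; rewrite /J /= rmorphM; apply: WM.
have JW w : W w -> J (along p w) by move=> Ww; rewrite /J /= alongK //; apply: mem_ideal_gen.
have [|c [h [c0 Jch hprim hJ]]] := ideal_poly_gcd (@factorial_mpoly n K) idJ.
  exists (along p f); first exact: JW.
  by rewrite -(rmorph0 (along p)) (can_eq (alongK p0)).
have FW w : W w -> divides (unalong p h) w.
  move=> /JW /hJ [q wq]; exists (unalong p q).
  by rewrite -[w](alongK p0) wq rmorphM.
have chF : unalong p (c%:P * h) = proj_along p c * unalong p h.
  by rewrite rmorphM /= unalongC.
exists (unalong p h), c; split=> //; last by rewrite -chF.
- by apply: contraNneq f0 => F0; have [q ->] := FW _ Wf; rewrite F0 mulr0.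
split=> // g gW; have gprim := along_factor_primitive (gW _ Wf).
have [q chq] : divides g (unalong p (c%:P * h)) by apply: divides_ideal_gen Jch.
have [|r hr] := gauss_primitive (factorial_mpoly c0) c0 gprim (f := h).
  by exists (along p q); rewrite -rmorphM /= -chq unalongK.
by exists (unalong p r); rewrite hr rmorphM /= alongK.
Qed.

End FormsGcd.

Section PlaneWithoutZero.
Variables (K : fieldType).
Local Notation S := {mpoly K[2]}.
Local Notation Y := ('X_(ord0 : 'I_2) : S).
Local Notation Z := ('X_(ord_max : 'I_2) : S).

Lemma form1E k (t : {mpoly K[1]}) : t \is k.-form -> exists a, t = a *: 'X_ord0 ^+ k.
Proof.
move=> tk; exists (\sum_(m <- msupp t) t@_m); rewrite {1}(mpolyE t) scaler_suml.
rewrite big_seq [RHS]big_seq; apply: eq_bigr => m /(dhomog_mf tk) mk.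
congr (_ *: _); rewrite mpolyXE_id big_ord1; congr (_ ^+ _).
by have {}mk : mdeg m = k := mk; rewrite -mk mdegE big_ord1.
Qed.

Lemma form2_modZ d (u : S) : u \is d.-form ->
  exists v, u = u.@[fun i => (i == ord0)%:R] *: Y ^+ d + Z * v.
Proof.
pose e (i : 'I_2) : K := (i == ord0)%:R.
move: u; apply: form2_ind.
- by exists 0; rewrite meval0 scale0r mulr0 addr0.
- move=> f g [v {1}->] [w {1}->]; exists (v + w).
  by rewrite mevalD scalerDl mulrDr addrACA.
- move=> c a [|b] abd.
    exists 0; rewrite mulr0 addr0 expr0 mulr1 mevalZ rmorphXn /= mevalXU eqxx.
    by rewrite expr1n mulr1 -abd addn0.
  exists (c *: (Y ^+ a * Z ^+ b)); rewrite mevalZ mevalM [X in _ * (_ * X)]rmorphXn /=.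
  by rewrite mevalXU expr0n /= !mulr0 scale0r add0r -scalerAr exprS mulrCA.
Qed.

(** Modulo the ideal, [Z] is nilpotent and a power of [Y] is a multiple of
    [Z]: the ideal contains powers of both variables. *)
Lemma full_degree (J : set S) (u : S) d k : is_ideal J -> J (Z ^+ k) -> J u ->
  u \is d.-form -> u.@[fun i => (i == ord0)%:R] != 0 ->
  exists D, forall s, s \is D.-form -> J s.
Proof.
move=> idJ JZ Ju ud; set a := u.@[_] => a0; have [J0 JD JM] := idJ.
have [v uE] := form2_modZ ud.
have JY : J ((Y ^+ d) ^+ k).
  have YE : Y ^+ d = a^-1%:MP * u + Z * (- (a^-1%:MP * v)).
    rewrite {1}uE -/a mulrDr !mul_mpolyC scalerA mulVf // scale1r.
    by rewrite mulrN -scalerAr addrK.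
  have : J ((Y ^+ d) ^+ k - (Z * (- (a^-1%:MP * v))) ^+ k).
    by rewrite subrXX mulrC (canLR (addrK _) YE); apply/JM/JM.
  move=> JYZ; rewrite -[(Y ^+ d) ^+ k](subrK ((Z * (- (a^-1%:MP * v))) ^+ k)).
  by apply: JD => //; rewrite exprMn mulrC; apply: JM.
exists (d * k + k)%N; apply: form2_ind => // c b e be.
rewrite -mul_mpolyC; apply: (JM).
have [kb|kb] := leqP (d * k) b.
  by rewrite -(subnK kb) exprD exprM mulrAC; apply: JM.
have ke : (k <= e)%N by lia.
by rewrite -(subnK ke) exprD mulrA; apply: JM.
Qed.

End PlaneWithoutZero.

(** The plane is spanned by a point [p] where some [f] in [W] does not vanish,
    nor does [f / F], and by a point [q] of the hyperplane [x_0 = 0] where the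
    polynomial [c] of [forms_gcd] does not vanish. Restricted to it, [f / F] has
    a term in [Y] alone, and [c] is a nonzero polynomial in [Z] alone. *)
Theorem forms_gcd_plane (n : nat) (K : fieldType) (charK0 : [pchar K] =i pred0)
    (W : set {mpoly K[n.+2]}) (m : nat) :
  (forall w, W w -> w \is m.-form) -> (exists2 f, W f & f != 0) ->
  exists (F : {mpoly K[n.+2]}) (B : 'M[K]_(n.+2, 2)) (C : 'M[K]_(2, n.+2)) D,
    [/\ is_gcd W F, C *m B = 1%:M, lsub B F != 0 &
        forall s, s \is D.-form ->
          [set lsub B g | g in ideal_gen (quotient_by W F)]%classic s].
Proof.
move=> Wm [f Wf f0].
have [p] : exists p, (f * 'X_ord0).@[p] != 0.
  by apply: mpoly_nonroot => //; rewrite mulf_neq0 // mpolyX_neq0.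
rewrite mevalM mevalXU mulf_eq0 negb_or => /andP[fp p0].
have [F [c [F0 gcdF c0 cF]]] := forms_gcd p0 Wm Wf fp.
have [q] : exists q, (c * 'X_ord0).@[q] != 0.
  by apply: mpoly_nonroot => //; rewrite mulf_neq0 // mpolyX_neq0.
rewrite mevalM mevalXU mulf_eq0 negb_or => /andP[cq q0].
pose B : 'M[K]_(n.+2, 2) := \matrix_(i, j)
  if j == ord0 then p i else oapp q 0 (unlift ord0 i).
have [C CB] : exists C : 'M[K]_(2, n.+2), C *m B = 1%:M.
  have : row_free B^T.
    apply: inj_row_free => v /rowP vB.
    have v0 : v 0 ord0 = 0.
      have := vB ord0; rewrite !mxE big_ord_recl big_ord1 !mxE /= unlift_none /= mulr0.
      by rewrite addr0 => /eqP; rewrite mulf_eq0 (negbTE p0) orbF => /eqP.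
    have v1 : v 0 ord_max = 0.
      have := vB (lift ord0 ord0); rewrite !mxE big_ord_recl big_ord1 !mxE /= liftK /=.
      rewrite v0 mul0r add0r => /eqP; rewrite mulf_eq0 (negbTE q0) orbF => /eqP <-.
      by congr (v 0 _); apply: val_inj.
    apply/rowP => j; rewrite mxE.
    have [->|->] // : j = ord0 \/ j = ord_max.
    by case: j => [[|[|//]] ?]; [left | right]; apply: val_inj.
  by case/row_freeP => X BX; exists X^T; rewrite -[B]trmxK -trmx_mul BX trmx1.
have BY g : (lsub B g).@[fun i => (i == ord0)%:R] = g.@[p].
  rewrite meval_lsub; apply: meval_eq => i.
  by rewrite big_ord_recl big_ord1 !mxE /= mulr1 mulr0 addr0.
have [u fu] := (proj1 gcdF) _ Wf.
have up : u.@[p] != 0 by apply: contraNneq fp => up; rewrite fu mevalM up mul0r.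
have Fp : F.@[p] != 0 by apply: contraNneq fp => Fp; rewrite fu mevalM Fp mulr0.
have [||i ui _] := @form_factors n.+2 K m u F.
- by rewrite -fu.
- by rewrite -fu; apply: Wm.
have [A AB] := plane_equations CB.
pose Jq := ideal_gen (quotient_by W F).
have Jc : Jq (proj_along p c) by apply: ideal_gen_quotient cF => //; case: gcdF.
have Ju : Jq u by apply: mem_ideal_gen; rewrite /quotient_by /= -fu.
have qform g : quotient_by W F g -> exists d, g \is d.-form.
  move=> Wg; have [->|g0] := eqVneq g 0; first by exists 0%N; apply: rpred0.
  have [||j gj _] := @form_factors n.+2 K m g F; last by exists j.
    by rewrite mulf_neq0.
  exact: Wm.
have hJq : homogeneous_ideal Jq := ideal_gen_homog qform.
have hJ := lsub_image_ideal AB hJq.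
(* On the plane [c] is constant along [p], hence a polynomial in [Z] alone; its
   nonzero components are multiples of powers of [Z]. *)
have [k JZ] : exists k, [set lsub B g | g in Jq]%classic ('X_(ord_max : 'I_2) ^+ k).
  pose Q : 'M[K]_(n.+1, 1) := \col_i q i; pose E : 'M[K]_(1, 2) := \row_j (j == ord_max)%:R.
  pose t := lsub Q c.
  have ct : lsub B (proj_along p c) = lsub E t.
    rewrite /t lsub_lsub.
    apply: (mpoly_morph_ext (f := lsub B \o proj_along p) (g := lsub _)) => [x|i'] /=.
      by rewrite proj_alongC !lsubC.
    rewrite proj_alongX rmorphB /= linearZ /= !lsubX !linformE !big_ord_recl !big_ord0.
    rewrite !mxE /= !big_ord_recl !big_ord0 !mxE /= unlift_none liftK /=.
    rewrite scale0r !addr0 mulr0 scale0r add0r mulr1 scalerA divfK //.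
    by rewrite addrC addKr.
  have t1 : t.@[fun=> 1] = c.@[q].
    rewrite meval_lsub; apply: meval_eq => j.
    by rewrite big_ord1 !mxE mulr1.
  have [k tk] : exists k, t.{k} != 0.
    by apply: homog_component_ne0; apply: contraNneq cq => t0; rewrite -t1 t0 meval0.
  have [a ta] := form1E (pihomogP _ k t).
  have a0 : a != 0 by apply: contraNneq tk => a0; rewrite ta a0 scale0r.
  exists k; have := (proj2 hJ) (lsub E t) k; rewrite lsub_comp ta linearZ rmorphXn /=.
  have -> : lsub E 'X_ord0 = 'X_ord_max.
    rewrite lsubX linformE big_ord_recl big_ord1 !mxE /= scale0r add0r scale1r.
    by congr 'X_ _; apply: val_inj.
  move=> JZ; have [_ _ JM] := proj1 hJ.
  have := JM a^-1%:MP _ (JZ _); rewrite mul_mpolyC scalerA mulVf // scale1r; apply.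
  by rewrite -ct; exists (proj_along p c).
have [|||D Dfull] := @full_degree K _ (lsub B u) i k (proj1 hJ) JZ.
- by exists u.
- exact: lsub_form.
- by rewrite BY.
exists F, B, C, D; split=> //.
by apply: contraNneq Fp => F0'; rewrite -BY F0' meval0.
Qed.

(** * Properties of generic planes *)

Section GenericPlanes.
Variables (K : fieldType) (charK0 : [pchar K] =i pred0) (n : nat).
Implicit Types (B : 'M[K]_(n.+2, 2)) (Q : 'M[K]_(n.+2, 2) -> Prop).
Local Open Scope classical_set_scope.

(** A property of the planes cut out by generic equations [A]; the basis [B] of
    the plane is arbitrary. *)
Definition generic_plane Q : Prop := exists U : set 'rV[K]_(n * n.+2),
  [/\ zariski_open U, U !=set0 &
      forall A B, U (mxvec A) -> plane A B -> Q B].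

Lemma generic_planeI Q Q' :
  generic_plane Q -> generic_plane Q' -> generic_plane (fun B => Q B /\ Q' B).
Proof.
move=> [U [oU U0 UQ]] [V [oV V0 VQ]].
have [oUV UV0] := zariski_openI charK0 oU oV U0 V0.
by exists (U `&` V); split=> // A B [UA VA] AB; split; [apply: UQ AB | apply: VQ AB].
Qed.

Lemma generic_plane_ex Q : generic_plane Q -> exists A B, plane A B /\ Q B.
Proof.
move=> [U [oU U0 UQ]].
pose M : 'M[{mpoly K[n * n.+2]}]_(n, n.+2) := \matrix_(i, j) 'X_(mxvec_index i j).
have ME (A : 'M[K]_(n, n.+2)) : map_mx (meval (mxvec A 0)) M = A.
  by apply/matrixP => i j; rewrite !mxE mevalXU mxvecE.
have [|V [oV VA VM]] := @row_free_open K _ _ _ M (mxvec (pid_mx n)).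
  by rewrite ME -row_leq_rank rank_pid_mx // -addn2 leq_addr.
have [|_ [v [Uv Vv]]] := zariski_openI charK0 oU oV U0; first by eexists; exact: VA.
have := VM _ Vv; rewrite -[v]vec_mxK ME => /plane_spanned [B AB].
exists (vec_mx v), B; split=> //; apply: UQ AB; by rewrite vec_mxK.
Qed.

Lemma generic_plane_section (I : set {mpoly K[n.+2]}) d : homogeneous_ideal I ->
  generic_plane (fun B => hilbert_fun (lsub B @` I) d = sectional_matrix I 2 d).
Proof.
move=> hI; have := sectional_matrixP hI 2 d; rewrite !subSS subn0.
move=> [U [oU U0 Ud]]; exists U; split=> // A B UA AB.
by rewrite -(hilbert_fun_plane AB d hI) Ud.
Qed.

Lemma generic_plane_hilbert_le (J : set {mpoly K[n.+2]}) d B0 (C : 'M[K]_(2, n.+2)) :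
  homogeneous_ideal J -> C *m B0 = 1%:M -> generic_plane (fun B =>
    (hilbert_fun (lsub B @` J) d <= hilbert_fun (lsub B0 @` J) d)%N).
Proof.
move=> hJ /plane_equations [A0 AB0].
have [U [oU UA0 Ule]] := hilbert_fun_semicontinuous hJ A0 d.
exists U; split=> // [|A B UA AB]; first by exists (mxvec A0).
by rewrite -(hilbert_fun_plane AB d hJ) -(hilbert_fun_plane AB0 d hJ) Ule.
Qed.

Lemma hilbert_fun_eq0 m (J : set {mpoly K[m.+1]}) d : is_ideal J ->
  hilbert_fun J d = 0%N <-> forall f, f \is d.-form -> J f.
Proof.
move=> idJ; split=> [J0 f fd|Jall].
  apply/(hspaceP idJ (DHomog fd)); have -> : hspace J d = fullv.
    by apply/eqP; rewrite eqEdim subvf /= -(hilbert_funK J d) J0.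
  exact: memvf.
apply/eqP; rewrite subn_eq0 dimvS //; apply/subvP => f _.
by apply/(hspaceP idJ)/Jall/dhomog_form.
Qed.

(** The properties of the plane given by [B0] that are conditions on a Hilbert
    function hold for generic planes, by semicontinuity. *)
Lemma generic_plane_full (J : set {mpoly K[n.+2]}) D B0 (C : 'M[K]_(2, n.+2)) :
  homogeneous_ideal J -> C *m B0 = 1%:M ->
  (forall s, s \is D.-form -> (lsub B0 @` J) s) ->
  generic_plane (fun B => forall s, s \is D.-form -> (lsub B @` J) s).
Proof.
move=> hJ CB0 full; have [A0 AB0] := plane_equations CB0.
have [U [oU U0 Ule]] := generic_plane_hilbert_le D hJ CB0.
exists U; split=> // A B UA AB.
have hJB := lsub_image_ideal AB hJ; have hJB0 := lsub_image_ideal AB0 hJ.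
apply/(hilbert_fun_eq0 D (proj1 hJB))/eqP.
have := Ule A B UA AB; have /(hilbert_fun_eq0 D (proj1 hJB0)) -> := full.
by rewrite leqn0.
Qed.

(** The restriction of [F] is nonzero exactly if the Hilbert function of the
    restricted ideal of [F] is not maximal in the degree of [F]. *)
Lemma generic_plane_neq0 (F : {mpoly K[n.+2]}) e B0 (C : 'M[K]_(2, n.+2)) :
  F \is e.-form -> C *m B0 = 1%:M -> lsub B0 F != 0 ->
  generic_plane (fun B => lsub B F != 0).
Proof.
move=> Fe CB0 FB0; have [A0 AB0] := plane_equations CB0.
have hJ : homogeneous_ideal (ideal_gen [set F]).
  by apply: ideal_gen_homog => _ ->; exists e.
have [U [oU U0 Ule]] := generic_plane_hilbert_le e hJ CB0.
exists U; split=> // A B UA AB; have := Ule A B UA AB.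
have hJB := lsub_image_ideal AB hJ; have hJB0 := lsub_image_ideal AB0 hJ.
apply: contraTneq => FB; rewrite -ltnNge.
have -> : hilbert_fun (lsub B @` ideal_gen [set F]) e = \dim {: dhomog 2 K e}.
  rewrite /hilbert_fun (_ : hspace _ e = 0%VS) ?dimv0 ?subn0 //.
  apply/eqP; rewrite -subv0; apply/subvP => s /(hspaceP (proj1 hJB)) [_ [l lF ->] sE].
  rewrite memv0; apply/eqP/val_inj; rewrite /= -sE rmorph_sum big_seq big1 // => u.
  by move=> /lF uF; rewrite rmorphM /= uF FB mulr0.
rewrite -(hilbert_funK (lsub B0 @` ideal_gen [set F]) e) -[X in (X < _)%N]addn0.
rewrite ltn_add2l lt0n dimv_eq0; apply: contra FB0 => /eqP H0.
have : DHomog (lsub_form B0 Fe) \in hspace (lsub B0 @` ideal_gen [set F]) e.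
  by apply/(hspaceP (proj1 hJB0)); exists F => //; apply: mem_ideal_gen.
by rewrite H0 memv0 => /eqP/(congr1 val) /= ->.
Qed.

End GenericPlanes.

(** * The degree of the common factor *)

Lemma idealT (R : comNzRingType) : is_ideal [set: R]%classic.
Proof. by split. Qed.

Lemma hspaceT n (K : fieldType) d : hspace [set: {mpoly K[n.+1]}]%classic d = fullv.
Proof. by apply/eqP; rewrite eqEsubv subvf; apply/subvP => s _; apply/hspaceP. Qed.

Section MultiplicationDimension.
Variables (K : fieldType) (n : nat) (J J' : set {mpoly K[n.+1]}).
Hypotheses (idJ : is_ideal J) (idJ' : is_ideal J').
Variables (G : {mpoly K[n.+1]}) (e d : nat) (Ge : G \is e.-form) (G0 : G != 0).

Lemma mulp_hspace_le : (forall s, s \is d.-form -> J s -> J' (G * s)) ->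
  (\dim (hspace J d) <= \dim (hspace J' (e + d)))%N.
Proof.
move=> GJ; pose mG := hmap (mulp G) d (e + d).
rewrite -(limg_dim_eq (f := mG) (U := hspace J d)); last first.
  by have /eqP -> := hmap_mulp_ker d Ge G0; rewrite capv0.
apply/dimvS/subvP => _ /memv_imgP [s /(hspaceP idJ) Js ->].
by apply/(hspaceP idJ'); rewrite hmap_mulpE //; apply: GJ => //; apply: dhomog_form.
Qed.

Lemma hspace_mulp_le :
  (forall s, s \is (e + d).-form -> J' s -> exists2 t, J t & s = G * t) ->
  (\dim (hspace J' (e + d)) <= \dim (hspace J d))%N.
Proof.
move=> J'G; pose mG := hmap (mulp G) d (e + d).
rewrite -(limg_dim_eq (f := mG) (U := hspace J d)); last first.
  by have /eqP -> := hmap_mulp_ker d Ge G0; rewrite capv0.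
apply/dimvS/subvP => s /(hspaceP idJ') /J'G [|t Jt sGt]; first exact: dhomog_form.
have td : t \is d.-form.
  have [->|t0] := eqVneq t 0; first exact: rpred0.
  have Gt0 : G * t != 0 by rewrite mulf_neq0.
  have [||i Gi [j tj eij]] := @form_factors n.+1 K (e + d) G t => //.
    by rewrite -sGt; apply: dhomog_form.
  have ei := dhomog_uniq G0 Ge Gi.
  by move: eij; rewrite ei => /addnI ->.
have -> : s = mG (DHomog td) by apply: val_inj; rewrite /= hmap_mulpE.
exact/memv_img/(hspaceP idJ).
Qed.

End MultiplicationDimension.

Section CommonFactor.
Variables (K : fieldType) (n : nat) (A : 'M[K]_(n, n.+2)) (B : 'M[K]_(n.+2, 2)).
Hypothesis AB : plane A B.
Variables (I : set {mpoly K[n.+2]}) (homI : homogeneous_ideal I).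
Local Open Scope classical_set_scope.

Local Notation rI := (lsub B @` I).
Local Notation rQ F m := (lsub B @` ideal_gen (quotient_by (homog_part I m) F)).

Let idrI : is_ideal rI := proj1 (lsub_image_ideal AB homI).

Section Factor.
Variables (F : {mpoly K[n.+2]}) (e m : nat).
Hypotheses (Fe : F \is e.-form) (FB : lsub B F != 0).
Hypothesis FI : forall f, homog_part I (e + m) f -> divides F f.

Let F0 : F != 0.
Proof. by apply: contraNneq FB => ->; rewrite rmorph0. Qed.

Lemma quotient_form q : quotient_by (homog_part I (e + m)) F q -> q \is m.-form.
Proof.
move=> [_ qF]; have [->|q0] := eqVneq q 0; first exact: rpred0.
have qF0 : q * F != 0 by rewrite mulf_neq0.
have [i qi [j Fj eij]] := form_factors qF0 qF.
by move: eij; rewrite (dhomog_uniq F0 Fe Fj) addnC => /addIn ->.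
Qed.

Lemma quotient_homog : homogeneous_ideal (ideal_gen (quotient_by (homog_part I (e + m)) F)).
Proof. by apply: ideal_gen_homog => q /quotient_form; exists m. Qed.

Let idrQ : is_ideal (rQ F (e + m)) := proj1 (lsub_image_ideal AB quotient_homog).

Lemma lsub_quotient g : rQ F (e + m) g -> rI (lsub B F * g).
Proof.
move=> [q Jq <-]; exists (F * q); last by rewrite rmorphM.
have [I0 ID IM] := proj1 homI; have [s sW ->] := Jq.
rewrite mulr_sumr big_seq; apply: ideal_sumP => [|u /sW]; first exact: (proj1 homI).
by move=> -[Iu _]; rewrite mulrCA [F * _]mulrC; apply: IM.
Qed.

Lemma dim_quotient_le j : (\dim (hspace (rQ F (e + m)) j) <= \dim (hspace rI (e + j)))%N.
Proof.
apply: (mulp_hspace_le idrQ idrI (lsub_form B Fe) FB) => s _.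
exact: lsub_quotient.
Qed.

Lemma dim_quotient : \dim (hspace (rQ F (e + m)) m) = \dim (hspace rI (e + m)).
Proof.
apply/eqP; rewrite eqn_leq dim_quotient_le /=.
apply: (hspace_mulp_le idrQ idrI (lsub_form B Fe) FB) => s sem [f If fs].
have Wf : homog_part I (e + m) f.{(e + m)%N}.
  by split; [apply: (proj2 homI) | apply: pihomogP].
have [q fq] := FI Wf; exists (lsub B q).
  by exists q => //; apply: mem_ideal_gen; rewrite /quotient_by /= -fq.
by rewrite -rmorphM /= mulrC -fq -lsub_comp fs pihomog_dE.
Qed.

(** Multiplication by [F] identifies the quotients with the forms of [I] on the
    plane, so that the dimension is computed on ideals of binary forms with no
    common zero. *)
Lemma dim_section_full D :
  (forall s, s \is D.-form -> rQ F (e + m) s) ->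
  (\dim (hspace (rQ F (e + m)) m.+1) <= (\dim (hspace rI (e + m))).+1)%N ->
  \dim (hspace rI (e + m)) = m.+1.
Proof.
move=> full; rewrite -dim_quotient.
have Wform s : (lsub B @` quotient_by (homog_part I (e + m)) F) s -> s \is m.-form.
  by move=> [q /quotient_form qm <-]; apply: lsub_form.
have := hspace_full Wform (D := D); rewrite -(lsub_image_gen AB) => H; exact: H.
Qed.

Lemma dim_quotientS_full :
  \dim (hspace rI (e + m)) = m.+1 -> \dim (hspace (rQ F (e + m)) m.+1) = m.+2.
Proof.
rewrite -dim_quotient => dimQ; have [_ QD QM] := idrQ.
have Qfull : forall s, s \is m.-form -> rQ F (e + m) s.
  apply/(hilbert_fun_eq0 m idrQ)/eqP; rewrite subn_eq0 dimQ dim_forms2 //.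
rewrite -(dim_forms2 K m.+1); congr (\dim _); apply/eqP; rewrite eqEsubv subvf.
apply/subvP => s _; apply/(hspaceP idrQ).
have [a [b [am bm ->]]] := form2_split (dhomog_form s).
by apply: QD; apply: QM; apply: Qfull.
Qed.

End Factor.

(** On the plane the forms of degree [e + m] of [I] are all the multiples of [F]
    of that degree, and likewise in the next degree, where the growth condition
    leaves no room for other forms. The ideal that they generate grows by one in
    each degree, and so do the quotients by [F'], which are thus all forms of
    degree [m']. *)
Lemma common_factor_degrees F F' e e' m m' D D' : (e + m).+1 = (e' + m')%N ->
  F \is e.-form -> lsub B F != 0 -> F' \is e'.-form -> lsub B F' != 0 ->
  (forall f, homog_part I (e + m) f -> divides F f) ->
  (forall f, homog_part I (e' + m') f -> divides F' f) ->
  (forall s, s \is D.-form -> rQ F (e + m) s) ->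
  (forall s, s \is D'.-form -> rQ F' (e' + m') s) ->
  (hilbert_fun rI (e + m) <= hilbert_fun rI (e + m).+1)%N ->
  e = hilbert_fun rI (e + m) /\ e' = e.
Proof.
move=> em Fe FB F'e F'B FI F'I full full' growth.
have dim0 := hilbert_funK rI (e + m); have dim1 := hilbert_funK rI (e + m).+1.
rewrite !dim_forms2 in dim0 dim1.
have dimF : \dim (hspace rI (e + m)) = m.+1.
  apply: (dim_section_full Fe FB FI full).
  have := dim_quotient_le m Fe FB m.+1; rewrite addnS; lia.
have dimQ := dim_quotientS_full Fe FB FI dimF.
have dimQ1 := dim_quotient_le m Fe FB m.+1.
have dimI1 : \dim (hspace rI (e + m.+1)) = m.+2.
  by move: dimQ1; rewrite dimQ addnS; lia.
split; first by lia.
pose M : set {mpoly K[2]} := [set s | divides (lsub B F) s].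
have idM : is_ideal M.
  by split; [apply: divides0 | move=> a b; apply: dividesD | move=> a b; apply: divides_mull].
have idT := @idealT {mpoly K[2]}.
have MI s : s \is (e + m.+1).-form -> rI s -> M s.
  suff eqM : hspace rI (e + m.+1) = hspace M (e + m.+1).
    by move=> sd /(hspaceP idrI (DHomog sd)); rewrite eqM => /(hspaceP idM).
  have subM : (hspace M (e + m.+1) <= hspace rI (e + m.+1))%VS.
    apply: hspaceS => // f fd [q fq].
    have qm : q \is m.+1.-form.
      have [->|q0] := eqVneq q 0; first exact: rpred0.
      have qF0 : q * lsub B F != 0 by rewrite mulf_neq0.
      have [||i qi [j Fj eij]] := @form_factors _ K (e + m.+1) q (lsub B F) => //.
        by rewrite -fq.
      by move: eij; rewrite (dhomog_uniq FB (lsub_form B Fe) Fj) addnC => /addIn ->.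
    rewrite fq mulrC; apply: (lsub_quotient (e := e) (m := m)).
    have hQ := lsub_image_ideal AB (quotient_homog m Fe FB).
    move: q qm {fq}; apply/(hilbert_fun_eq0 m.+1 (proj1 hQ))/eqP.
    by rewrite subn_eq0 dimQ dim_forms2.
  apply/esym/eqP; rewrite eqEdim subM dimI1 -(dim_forms2 K m.+1).
  rewrite -(hspaceT 1 K m.+1).
  apply: (mulp_hspace_le idT idM (lsub_form B Fe) FB) => t _ _.
  by exists t; rewrite mulrC.
have dimF' : \dim (hspace rI (e' + m')) = m'.+1.
  apply: (dim_section_full F'e F'B F'I full').
  have -> : \dim (hspace rI (e' + m')) = m.+2 by rewrite -em -addnS.
  have hQ' := lsub_image_ideal AB (quotient_homog m' F'e F'B).
  apply: (@leq_trans (\dim (hspace M (e' + m'.+1)))).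
    apply: (mulp_hspace_le (proj1 hQ') idM (lsub_form B F'e) F'B) => s _.
    rewrite (lsub_image_gen AB) => -[l lW ->]; rewrite mulr_sumr big_seq.
    apply: ideal_sumP => // u /lW [q Wq <-]; rewrite mulrCA.
    have [_ _ MM] := idM; apply: MM; apply: MI.
      rewrite addnS em; apply: dhomogM; apply: lsub_form => //.
      exact: quotient_form F'e F'B _ Wq.
    by apply: (lsub_quotient (e := e') (m := m')); exists q => //; apply: mem_ideal_gen.
  rewrite addnS -em -!addnS -(dim_forms2 K m.+2).
  rewrite -(hspaceT 1 K m.+2).
  apply: (hspace_mulp_le idT idM (lsub_form B Fe) FB) => s _ [t ->].
  by exists t => //; rewrite mulrC.
move: dimF'; rewrite -em -addnS dimI1; lia.
Qed.

End CommonFactor.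

(** * Common divisors in neighbouring degrees *)

(** If [a g = X_i f] and [b g = X_j f], then [a X_j = b X_i] and every monomial
    of [a] contains [X_i]. *)
Lemma divides_mulX2 (K : fieldType) n (i j : 'I_n) (g f : {mpoly K[n]}) : i != j ->
  divides g ('X_i * f) -> divides g ('X_j * f) -> divides g f.
Proof.
move=> ij [a fa] [b fb].
have [g0|g0] := eqVneq g 0.
  move: fa; rewrite g0 mulr0 => /eqP; rewrite mulf_eq0 (negbTE (mpolyX_neq0 _ _)).
  by move=> /eqP ->; apply: divides0.
have ab : a * 'X_j = b * 'X_i.
  apply: (mulIf g0); rewrite mulrAC -fa [b * _ * g]mulrAC -fb.
  by rewrite mulrAC [RHS]mulrAC ['X_i * 'X_j]mulrC.
have [q aq] : divides 'X_i a.
  rewrite (mpolyE a) big_seq; apply: divides_sum => m am.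
  have mi : (U_(i) <= m)%MM.
    have : (U_(j) + m)%MM \in msupp (b * 'X_i).
      by rewrite -ab mcoeff_msupp mcoeffMX -mcoeff_msupp.
    rewrite (perm_mem (msuppMX _ _)) => /mapP [m' _ /mnmP /(_ i)].
    by rewrite !mnmDE !mnm1E eqxx eq_sym (negbTE ij) add0n lep1mP => ->.
  exists (a@_m *: 'X_[m - U_(i)]).
  by rewrite -scalerAl -mpolyXD submK.
by exists q; apply: (mulfI (mpolyX_neq0 K i)); rewrite fa aq mulrA [_ * q]mulrC.
Qed.

Section CommonDivisors.
Variables (K : fieldType) (n : nat) (I : set {mpoly K[n.+2]}).
Hypothesis homI : homogeneous_ideal I.

Lemma homog_part_mulX d i f : homog_part I d f -> homog_part I d.+1 ('X_i * f).
Proof.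
move=> [If fd]; split; last exact: (dhomogM (form_X _ i) fd).
by have [_ _ IM] := proj1 homI; apply: IM.
Qed.

Lemma divides_homog_part_lower d k g :
  (forall f, homog_part I (d + k) f -> divides g f) ->
  forall f, homog_part I d f -> divides g f.
Proof.
elim: k d => [|k IH] d gI f Idf; first by apply: gI; rewrite addn0.
have gX i : divides g ('X_i * f).
  by apply: (IH d.+1) (homog_part_mulX i Idf) => h; rewrite addSnnS; apply: gI.
by apply: (@divides_mulX2 _ _ ord0 ord_max).
Qed.

Lemma divides_ideal_le d g :
  (forall f, homog_part I d f -> divides g f) <->
  (forall f, ideal_le I d f -> divides g f).
Proof.
split=> gI; last first.
  by move=> f If; apply: gI; apply: mem_ideal_gen; exists d => //=.
apply: divides_ideal_gen => f [d' /= le_d'd]; rewrite -(subnKC le_d'd) in gI.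
exact: divides_homog_part_lower gI f.
Qed.

End CommonDivisors.

(** * Maximal growth and the greatest common divisor *)

Theorem corollary6p7 (K : fieldType) (charK0 : [pchar K] =i pred0)
    (n : nat) (I : set {mpoly K[n.+1]}) (homI : homogeneous_ideal I)
    (delta : nat) (Idelta_neq0 : homog_part I delta <> [set 0]%classic)
    (growth : exists i : nat, (2 <= i <= n.+1)%N /\ maximal_growth I i delta) :
  exists F : {mpoly K[n.+1]},
    [/\ is_gcd (ideal_le I delta) F,
        is_gcd (ideal_le I delta.+1) F &
        msize F = (gcd_potential_degree I delta).+1].
Proof.
have [i [/andP[i2 iN] growth_i]] := growth.
case: n I homI Idelta_neq0 growth growth_i iN => [|n] I homI Idelta_neq0 _ growth_i iN.
  by case: i i2 iN {growth_i} => [|[|]].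
have hk : (sectional_matrix I 2 delta <= sectional_matrix I 2 delta.+1)%N.
  by apply: (maximal_growth2 charK0 homI _ growth_i); rewrite i2.
have [f If f0] : exists2 f, homog_part I delta f & f != 0.
  apply: contrapT => noF; apply: Idelta_neq0; apply/seteqP; split=> f.
    by move=> If; apply: contrapT => /eqP f0; apply: noF; exists f.
  by move=> ->; split; [case: (proj1 homI) | apply: rpred0].
have If1 : homog_part I delta.+1 ('X_ord0 * f) by apply: homog_part_mulX.
have f10 : 'X_ord0 * f != 0 by rewrite mulf_neq0 // mpolyX_neq0.
have factor d F h : homog_part I d h -> h != 0 -> divides F h ->
    exists e m, F \is e.-form /\ d = (e + m)%N.
  move=> [_ hd] h0 [q hq]; have [||j _ [e Fe ->]] := @form_factors _ K d q F.
  - by rewrite -hq.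
  - by rewrite -hq.
  by exists e, j; rewrite addnC.
have [F [B0 [C [D [gcdF CB0 FB0 full]]]]] :=
  forms_gcd_plane charK0 (W := homog_part I delta) (m := delta)
    (fun w Iw => proj2 Iw) (ex_intro2 _ _ f If f0).
have [F' [B0' [C' [D' [gcdF' CB0' FB0' full']]]]] :=
  forms_gcd_plane charK0 (W := homog_part I delta.+1) (m := delta.+1)
    (fun w Iw => proj2 Iw) (ex_intro2 _ _ _ If1 f10).
have [FI Fmax] := gcdF; have [F'I F'max] := gcdF'.
have [e [m [Fe dE]]] := factor _ _ _ If f0 (FI _ If).
have [e' [m' [F'e dE']]] := factor _ _ _ If1 f10 (F'I _ If1).
have F'_F : divides F' F.
  apply: Fmax; apply: (divides_homog_part_lower homI (k := 1)) => h.
  by rewrite addn1; apply: F'I.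
have F0 : F != 0 by apply: contraNneq FB0 => ->; rewrite rmorph0.
have F'0 : F' != 0 by apply: contraNneq FB0' => ->; rewrite rmorph0.
have [ek e'e] : e = sectional_matrix I 2 delta /\ e' = e.
  have homQ d G c : G \is c.-form -> G != 0 ->
      homogeneous_ideal (ideal_gen (quotient_by (homog_part I d) G)).
    move=> Ga G0; apply: ideal_gen_homog => q [_ qG].
    have [->|q0] := eqVneq q 0; first by exists 0%N; apply: rpred0.
    by have [j qj _] := form_factors (mulf_neq0 q0 G0) qG; exists j.
  have g1 := generic_plane_section delta homI.
  have g2 := generic_plane_section delta.+1 homI.
  have g3 := generic_plane_full (homQ _ _ _ Fe F0) CB0 full.
  have g4 := generic_plane_full (homQ _ _ _ F'e F'0) CB0' full'.
  have g5 := generic_plane_neq0 Fe CB0 FB0.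
  have g6 := generic_plane_neq0 F'e CB0' FB0'.
  have [A [B [AB [[[hB hB'] [fullB fullB']] [FB F'B]]]]] :=
    generic_plane_ex charK0 (generic_planeI charK0 (generic_planeI charK0
      (generic_planeI charK0 g1 g2) (generic_planeI charK0 g3 g4))
      (generic_planeI charK0 g5 g6)).
  rewrite -hB -hB' in hk; rewrite -hB.
  rewrite dE in FI fullB; rewrite dE' in F'I fullB'.
  have em : (e + m).+1 = (e' + m')%N by rewrite -dE.
  rewrite dE in hk *.
  exact: (common_factor_degrees AB homI em Fe FB F'e F'B FI F'I fullB fullB' hk).
have F_F' : divides F F'.
  have [x FxF'] := F'_F.
  have xF'0 : x * F' != 0 by rewrite -FxF'.
  have [||j xj [l F'l ejl]] := @form_factors _ K e x F' => //; first by rewrite -FxF'.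
  have j0 : j = 0%N.
    have := dhomog_uniq F'0 F'e F'l; move: ejl; rewrite e'e => -> /eqP.
    by rewrite -{2}[l]add0n eqn_add2r => /eqP.
  move: xj; rewrite j0 => /form0_const; set c := _@_0 => xc.
  have c0 : c != 0.
    by apply: contraNneq xF'0 => c0; rewrite xc c0 mpolyC0 mul0r.
  by exists (c^-1)%:MP; rewrite FxF' xc mulrA -mpolyCM mulVf // mul1r.
exists F; split.
- split; first exact/(divides_ideal_le homI).
  by move=> G /(divides_ideal_le homI); apply: Fmax.
- split=> [h|G GI].
    move: h; apply/(divides_ideal_le homI) => h /F'I; exact: divides_trans.
  have GF' : divides G F' by apply: F'max; apply/(divides_ideal_le homI).
  exact: divides_trans F'_F.
- by rewrite (msize_form F0 Fe) ek.
Qed.
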